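(* For every Lipschitz domain $\Omega\subset\mathbb{R}^3$ one has $S_{\mathrm{curl}}(\Omega)=S_{\mathrm{curl}}$, where $S_{\mathrm{curl}}:=S_{\mathrm{curl}}(\mathbb{R}^3)$.
   Context: Write $|\cdot|_q$ for the $L^q$-norm; $\nabla\times u$ is the curl in the distributional sense. For a Lipschitz domain $\Omega\subset\mathbb{R}^3$ let $W^6(\mathrm{curl};\Omega):=\{u\in L^6(\Omega,\mathbb{R}^3):\nabla\times u\in L^2(\Omega,\mathbb{R}^3)\}$ with norm $(|u|_6^2+|\nabla\times u|_2^2)^{1/2}$, and let $W_0^6(\mathrm{curl};\Omega)$ be the closure of $\mathcal{C}_0^\infty(\Omega,\mathbb{R}^3)$ in $W^6(\mathrm{curl};\Omega)$. Extending functions by $0$ outside $\Omega$, one regards $W_0^6(\mathrm{curl};\Omega)\subset W_0^6(\mathrm{curl};\mathbb{R}^3)$. Let $\mathcal{W}:=\{w\in W_0^6(\mathrm{curl};\mathbb{R}^3):\nabla\times w=0\}$. $S_{\mathrm{curl}}(\Omega)$ is the largest possible constant such that $$\int_{\mathbb{R}^3}|\nabla\times u|^2\,dx\ge S_{\mathrm{curl}}(\Omega)\inf_{w\in\mathcal{W}}\Big(\int_{\mathbb{R}^3}|u+w|^6\,dx\Big)^{1/3}$$ holds for every $u\in W_0^6(\mathrm{curl};\Omega)\setminus\mathcal{W}$. (Here $u$, but not necessarily $w$, is supported in $\overline\Omega$.) *)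

(* Defs.v *)
From HB Require Import structures.
From mathcomp Require Import all_boot all_order all_algebra.
From mathcomp Require Import all_classical all_reals all_analysis.
Import Order.TTheory GRing.Theory Num.Theory.
Import numFieldNormedType.Exports.

Set Implicit Arguments.
Unset Strict Implicit.
Unset Printing Implicit Defensive.

Local Open Scope classical_set_scope.
Local Open Scope ring_scope.

(* R^3 is R * R * R, with coordinates x.1.1, x.1.2 and x.2. The library norm on
   this type is the sup norm; below it matters only through its topology, and
   |.| is the Euclidean norm [norm3]. *)

Section euclidean.
Context {R : realType}.

Definition dot3 (a b : R * R * R) : R :=
  a.1.1 * b.1.1 + a.1.2 * b.1.2 + a.2 * b.2.

Definition norm3 (a : R * R * R) : R := Num.sqrt (dot3 a a).

Definition orthonormal3 (a b c : R * R * R) : Prop :=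
  [/\ dot3 a a = 1, dot3 b b = 1 & dot3 c c = 1] /\
  [/\ dot3 a b = 0, dot3 a c = 0 & dot3 b c = 0].

(* Domain = nonempty connected open set. The boundary condition is local: near
   each boundary point, in suitable Cartesian coordinates, Omega is the strict
   epigraph of a Lipschitz function. It is void for Omega = R^3. *)
Definition lipschitz_domain (Omega : set (R * R * R)) : Prop :=
  [/\ open Omega, connected Omega, Omega !=set0 &
    forall x0, (closure Omega `\` Omega) x0 ->
      exists (a b c : R * R * R) (gamma : R * R -> R),
        [/\ orthonormal3 a b c, lipschitz gamma &
          \forall y \near x0,
            Omega y <-> gamma (dot3 a y, dot3 b y) < dot3 c y]].

End euclidean.

Section lebesgue.
Context {R : realType}.

(* [measurableTypeR R] is R itself, with the display carried by
   [lebesgue_measure]. *)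
Definition vol :
  {measure set (measurableTypeR R * measurableTypeR R * measurableTypeR R)%type
     -> \bar R} :=
  ((@lebesgue_measure R \x @lebesgue_measure R) \x @lebesgue_measure R)%E.

Definition measurable_field (Omega : set (R * R * R))
    (u : R * R * R -> R * R * R) : Prop :=
  measurable_fun
    (Omega : set (measurableTypeR R * measurableTypeR R * measurableTypeR R)%type)
    u.

Definition ext0 (Omega : set (R * R * R)) (u : R * R * R -> R * R * R) :
  R * R * R -> R * R * R := patch (cst 0) Omega u.

Definition Lp_norm (p : R) (Omega : set (R * R * R))
    (u : R * R * R -> R * R * R) : \bar R :=
  Lnorm vol p%:E (fun x => (norm3 (ext0 Omega u x))%:E).

Definition in_Lp (p : R) (Omega : set (R * R * R))
    (u : R * R * R -> R * R * R) : Prop :=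
  measurable_field Omega u /\ (Lp_norm p Omega u < +oo)%E.

Definition locally_integrable_field (Omega : set (R * R * R))
    (u : R * R * R -> R * R * R) : Prop :=
  measurable_field Omega u /\
  forall K, K `<=` Omega -> compact K ->
    (\int[vol]_(x in K) (norm3 (u x))%:E < +oo)%E.

End lebesgue.

Section curl.
Context {R : realType}.
Implicit Types (Omega : set (R * R * R)) (u v w phi : R * R * R -> R * R * R).

Definition curl phi (x : R * R * R) : R * R * R :=
  let d1 := 'D_(1, 0, 0) phi x in
  let d2 := 'D_(0, 1, 0) phi x in
  let d3 := 'D_(0, 0, 1) phi x in
  (d2.2 - d3.1.2, d3.1.1 - d1.2, d1.1.2 - d2.1.1).

Definition smooth phi : Prop :=
  forall (dirs : seq (R * R * R)) (x : R * R * R),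
    differentiable (foldr (fun d f => 'D_d f) phi dirs) x.

(* C_0^oo(Omega, R^3), as functions on R^3 vanishing outside of Omega. *)
Definition test_field Omega phi : Prop :=
  [/\ smooth phi, compact (closure [set x | phi x != 0]) &
      closure [set x | phi x != 0] `<=` Omega].

(* v is the distributional curl of u in Omega. It is determined by u up to a.e.
   equality in Omega, and curl is formally self-adjoint: there is no sign. *)
Definition is_weak_curl Omega u v : Prop :=
  [/\ locally_integrable_field Omega u, locally_integrable_field Omega v &
    forall phi, test_field Omega phi ->
      \int[vol]_(x in Omega) dot3 (u x) (curl phi x) =
      \int[vol]_(x in Omega) dot3 (v x) (phi x)].

(* Only the values of u in Omega matter in [W6curl] and [W06curl]. *)
Definition W6curl Omega : set (R * R * R -> R * R * R) :=
  [set u | in_Lp 6 Omega u /\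
           exists v, is_weak_curl Omega u v /\ in_Lp 2 Omega v].

(* The norm of u in W6curl Omega, given its weak curl v. *)
Definition W6curl_norm Omega u v : \bar R :=
  ((Lp_norm 6 Omega u ^+ 2 + Lp_norm 2 Omega v ^+ 2) `^ 2^-1)%E.

(* Closure of C_0^oo(Omega, R^3) in W6curl Omega. *)
Definition W06curl Omega : set (R * R * R -> R * R * R) :=
  [set u | W6curl Omega u /\
    forall e : R, 0 < e -> exists phi, test_field Omega phi /\
      exists v, is_weak_curl Omega (u \- phi) v /\
                (W6curl_norm Omega (u \- phi)%R v < e%:E)%E].

Definition curl_free : set (R * R * R -> R * R * R) :=
  [set w | W06curl setT w /\ is_weak_curl setT w (cst 0)].

Definition Scurl_bound Omega (S : R) : Prop :=
  forall u, W06curl Omega u -> ~ curl_free (ext0 Omega u) ->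
  forall v, is_weak_curl setT (ext0 Omega u) v ->
    (S%:E * ereal_inf [set (\int[vol]_x (norm3 (ext0 Omega u x + w x) ^+ 6)%:E)
                             `^ 3^-1 | w in curl_free]
     <= \int[vol]_x (norm3 (v x) ^+ 2)%:E)%E.

(* The admissible constants form a closed down-set containing 0, so the supremum
   is the largest one unless all constants are admissible, when it is +oo. *)
Definition Scurl Omega : \bar R := ereal_sup [set S%:E | S in Scurl_bound Omega].

End curl.

(* Main.v *)
Require Import Defs.
From HB Require Import structures.
From mathcomp Require Import all_boot all_order all_algebra.
From mathcomp Require Import all_classical all_reals all_analysis.
From mathcomp Require Import measurable_realfun ring.
Import Order.TTheory GRing.Theory Num.Theory.
Import numFieldNormedType.Exports.

Set Implicit Arguments.
Unset Strict Implicit.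
Unset Printing Implicit Defensive.

Local Open Scope classical_set_scope.
Local Open Scope ring_scope.

(* Both members are the best constant in the inequality restricted to smooth
   compactly supported fields on the whole space. If S is admissible for an open
   nonempty Omega and phi is such a field, then a suitable phi(l x + b) is supported
   in a ball of Omega; the kernel of the curl and the ratio of |curl u|_2^2 to
   |u + w|_6^2 are invariant under this change of variables, so phi satisfies the
   inequality with S. Conversely, by density, the inequality for such fields extends
   to W_0^6(curl; Omega). *)

(** A field in [W06curl setT] need not have bounded support, so it cannot be squeezed into a ball;
    this is why the two domains are compared through compactly supported fields. The fields [w],
    which live on the whole space, are carried along by the inverse affine map. The infimum over [w]
    is not known to be attained, so both directions work with an arbitrary error [e] and with norms
    rather than their squares. A curl-free [phi] is excluded from [Scurl_bound] but not from the
    intermediate inequality; there [w = - phi] settles it. In the density step the approximation of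
    [u] comes with a weak curl of [u - phi] in [Omega] only, whereas the energy of [u] is that of a
    weak curl of its zero extension on the whole space. The two are compared by testing against
    [curl phi], whose support lies in [Omega]. This rests on the self-adjointness of the curl on
    test fields, hence on integration by parts in R^3. *)

(** * Integrals under a map that scales the measure by a constant *)

Section scaling_map.
Context d (T : measurableType d) (R : realType).
Variables (m : {measure set T -> \bar R}) (phi : T -> T) (c : R).
Hypotheses (c_gt0 : (0 < c)%R) (mphi : measurable_fun setT phi).
Hypothesis m_phi : forall A, measurable A -> (m A = c%:E * m (phi @^-1` A))%E.
Local Open Scope ereal_scope.

(** By [m_phi], the measure [m] is [c] times its own image under [phi], so this is the formula for
    integrals against an image measure. *)
Lemma ge0_integral_scaling (f : T -> \bar R) :
  measurable_fun setT f -> (forall x, 0 <= f x) ->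
  \int[m]_x f x = c%:E * \int[m]_x f (phi x).
Proof.
move=> mf f0; pose k := NngNum (ltW c_gt0).
pose mu := mscale k (pushforward m phi).
rewrite (eq_measure_integral (mu mphi)) => [|A mA _]; last exact: m_phi.
by rewrite ge0_integral_mscale//= ge0_integral_pushforward.
Qed.

Lemma integrable_scaling (f : T -> \bar R) :
  m.-integrable setT f -> m.-integrable setT (f \o phi).
Proof.
move=> /integrableP[mf foo]; apply/integrableP; split.
  exact: measurableT_comp mf mphi.
rewrite ge0_integral_scaling// in foo; last exact: measurableT_comp.
rewrite -(@lte_pmul2l _ c%:E) ?lte_fin//.
by rewrite (lt_le_trans foo)// gt0_muley ?lte_fin// leey.
Qed.

Lemma Rintegral_scaling (f : T -> R) : m.-integrable setT (EFin \o f) ->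
  (\int[m]_x f x = c * \int[m]_x f (phi x))%R.
Proof.
move=> intf.
have mf : measurable_fun setT (EFin \o f) by case/integrableP: intf.
have intfa := integrable_scaling intf.
rewrite /Rintegral -[c]/(fine c%:E) -fineM//; last exact: integrable_fin_num intfa.
congr fine.
rewrite integralE [in RHS]integralE.
rewrite ge0_integral_scaling// ?[X in _ - X]ge0_integral_scaling//.
(* Pulling [c] out of the difference needs the latter to be well defined; it is, since the negative
   part of the integrable [f \o phi] has a finite integral. *)
- rewrite -muleBr//; first by
    congr (_ * (_ - _)); apply: eq_integral => x _; rewrite ?funeposE ?funenegE.
  rewrite fin_num_adde_defl// fin_numN.
  have := integrable_neg_fin_num measurableT intfa; congr (_ \is a fin_num).
  by apply: eq_integral => x _; rewrite !funenegE.
- exact: measurable_funeneg.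
- exact: measurable_funepos.
Qed.
End scaling_map.

(** * The change of variables x -> l x + b in R^3, with Jacobian l^3 *)

Section affine_change_of_variables.
Context {R : realType}.
Local Notation M := (measurableTypeR R).
Local Notation V := (R * R * R)%type.
Local Open Scope ereal_scope.

(** The measure on the right gives every half-open interval its length, and this property
    characterizes Lebesgue measure. *)
Lemma lebesgue_measure_affine (l b : R) (A : set M) : (0 < l)%R ->
  measurable A ->
  lebesgue_measure A =
    l%:E * lebesgue_measure ((fun t : M => (l * t + b)%R : M) @^-1` A).
Proof.
move=> l0 mA.
have mT : measurable_fun [set: M] (fun t : M => (l * t + b)%R : M).
  apply: continuous_measurable_fun.
  move=> t; apply: cvgD; last exact: cvg_cst.
  by apply: cvgM; [exact: cvg_cst|exact: cvg_id].
pose nnl := NngNum (ltW l0).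
pose mu := mscale nnl (pushforward (@lebesgue_measure R) (fun t : M => (l * t + b)%R : M)).
rewrite (lebesgue_measure_unique (mu := mu mT)) // => X [[x1 x2] /= _ <-].
rewrite lebesgue_measure_itv /= lte_fin /mu /mscale /= /pushforward.
have -> : (fun t : M => (l * t + b)%R : M) @^-1` `]x1, x2]%classic%R =
   (`](x1 - b) / l, (x2 - b) / l]%classic)%R :> set R.
  apply/seteqP; split => t /=; rewrite !in_itv/= ltr_pdivrMr// ler_pdivlMr//;
  by rewrite ltrBlDr lerBrDr mulrC.
rewrite [lebesgue_measure _]lebesgue_measure_itv /= lte_fin ltr_pM2r ?invr_gt0// ltrD2r.
case: ifP => _; last by rewrite mule0.
rewrite -!EFinB -EFinM; congr EFin.
by field; rewrite gt_eqF.
Qed.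

(** The scaled image of the product measure has the right values on rectangles, and a product of
    sigma-finite measures is determined by these. Two applications build R^3 from the line. *)
Lemma product_measure_pushforward d1 d2 (T1 : measurableType d1)
    (T2 : measurableType d2) (m1 : {sigma_finite_measure set T1 -> \bar R})
    (m2 : {sigma_finite_measure set T2 -> \bar R}) (f1 : T1 -> T1) (f2 : T2 -> T2)
    (c1 c2 : R) :
  (0 < c1)%R -> (0 < c2)%R ->
  measurable_fun setT f1 -> measurable_fun setT f2 ->
  (forall A, measurable A -> m1 A = c1%:E * m1 (f1 @^-1` A)) ->
  (forall A, measurable A -> m2 A = c2%:E * m2 (f2 @^-1` A)) ->
  forall X, measurable X ->
  (m1 \x m2) X = (c1 * c2)%:E * (m1 \x m2) ((fun x => (f1 x.1, f2 x.2)) @^-1` X).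
Proof.
move=> c1_gt0 c2_gt0 mf1 mf2 m1E m2E X mX.
pose f := (fun x : T1 * T2 => (f1 x.1, f2 x.2)).
have mf : measurable_fun setT f.
  apply: measurable_fun_pair; exact: measurableT_comp.
pose k := NngNum (ltW (mulr_gt0 c1_gt0 c2_gt0)).
pose mu := mscale k (pushforward (m1 \x m2) f).
rewrite (product_measure_unique (m' := mu mf)) // => A B mA mB.
transitivity ((c1 * c2)%:E * (m1 \x m2) ((f1 @^-1` A) `*` (f2 @^-1` B))); first by [].
have mf1A : measurable (f1 @^-1` A) by rewrite -[X in measurable X]setTI; exact: mf1.
have mf2B : measurable (f2 @^-1` B) by rewrite -[X in measurable X]setTI; exact: mf2.
rewrite product_measure1E// (m1E A)// (m2E B)// EFinM.
by rewrite muleACA.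
Qed.

Definition affine3 (l : R) (b : V) (x : V) : V := (l *: x + b)%R.

Lemma measurable_affine1 (l b : R) :
  measurable_fun [set: M] (fun t : M => (l * t + b)%R : M).
Proof.
apply: continuous_measurable_fun => t; apply: cvgD; last exact: cvg_cst.
by apply: cvgM; [exact: cvg_cst|exact: cvg_id].
Qed.

Lemma measurable_affine3 (l : R) (b : V) :
  measurable_fun [set: M * M * M] (affine3 l b : M * M * M -> M * M * M).
Proof.
apply: measurable_fun_pair; [apply: measurable_fun_pair|].
- apply: (measurableT_comp (measurable_affine1 l b.1.1)).
  exact: measurableT_comp.
- apply: (measurableT_comp (measurable_affine1 l b.1.2)).
  exact: measurableT_comp.
- exact: (measurableT_comp (measurable_affine1 l b.2)).
Qed.

Lemma vol_affine (l : R) (b : V) (A : set (M * M * M)) : (0 < l)%R ->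
  measurable A -> vol A = (l ^+ 3)%:E * vol ((affine3 l b : M * M * M -> M * M * M) @^-1` A).
Proof.
move=> l0 mA.
pose f1 := fun x : M * M => ((l * x.1 + b.1.1)%R : M, (l * x.2 + b.1.2)%R : M).
pose f2 := fun t : M => (l * t + b.2)%R : M.
have mf1 : measurable_fun setT f1.
  apply: measurable_fun_pair.
  + exact: (measurableT_comp (measurable_affine1 l b.1.1)).
  + exact: (measurableT_comp (measurable_affine1 l b.1.2)).
have E2 c (B : set M) (mB : measurable B) := lebesgue_measure_affine c l0 mB.
have E1 := product_measure_pushforward l0 l0 (measurable_affine1 l b.1.1)
  (measurable_affine1 l b.1.2) (E2 _) (E2 _).
(* In the second application the first factor is the planar product measure, which has to be
   packaged as a sigma-finite measure. *)
have sf := lebesgue_integral_fubini.product_measure_sigma_finite_subproof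
  (@lebesgue_measure R) (@lebesgue_measure R).
pose sfm := Measure_isSigmaFinite.Build _ _ _
  (@lebesgue_measure R \x @lebesgue_measure R) sf.
pose m12 : {sigma_finite_measure set (M * M)%type -> \bar R} :=
  HB.pack_for {sigma_finite_measure set (M * M)%type -> \bar R}
    (@lebesgue_measure R \x @lebesgue_measure R) sfm.
have E := product_measure_pushforward
  (m1 := m12) (m2 := @lebesgue_measure R)
  (mulr_gt0 l0 l0) l0 mf1
  (measurable_affine1 l b.2) E1 (E2 _) mA.
have -> : (l ^+ 3 = l * l * l)%R by ring.
exact: E.
Qed.

Lemma ge0_integral_affine (l : R) (b : V) (f : M * M * M -> \bar R) : (0 < l)%R ->
  measurable_fun setT f -> (forall x, 0 <= f x) ->
  \int[vol]_x f x = (l ^+ 3)%:E * \int[vol]_x f (affine3 l b x).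
Proof.
move=> l0; exact: (ge0_integral_scaling (exprn_gt0 3 l0) (measurable_affine3 l b)
  (fun A => vol_affine b l0)).
Qed.

Lemma integrable_affine (l : R) (b : V) (f : M * M * M -> \bar R) : (0 < l)%R ->
  vol.-integrable setT f -> vol.-integrable setT (f \o affine3 l b).
Proof.
move=> l0; exact: (integrable_scaling (exprn_gt0 3 l0) (measurable_affine3 l b)
  (fun A => vol_affine b l0)).
Qed.

Lemma Rintegral_affine (l : R) (b : V) (f : M * M * M -> R) : (0 < l)%R ->
  vol.-integrable setT (EFin \o f) ->
  (\int[vol]_x f x = l ^+ 3 * \int[vol]_x f (affine3 l b x))%R.
Proof.
move=> l0; exact: (Rintegral_scaling (exprn_gt0 3 l0) (measurable_affine3 l b)
  (fun A => vol_affine b l0)).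
Qed.
End affine_change_of_variables.

(** * Open sets and continuous maps for the product sigma-algebra of R^3 *)

Section measurability3.
Context {R : realType}.
Local Notation M := (measurableTypeR R).
Local Notation V := (R * R * R)%type.

Lemma bigcup_countType_measurable d (T : measurableType d) (I : countType)
    (P : set I) (F : I -> set T) :
  (forall i, measurable (F i)) -> measurable (\bigcup_(i in P) F i).
Proof.
move=> mF.
pose G n := if unpickle n is Some i then (if `[< P i >] then F i else set0) else set0.
have -> : \bigcup_(i in P) F i = \bigcup_n G n.
  apply/seteqP; split => [x [i Pi Fix]|x [n _]].
    by exists (pickle i) => //; rewrite /G pickleK; case: asboolP.
  by rewrite /G; case: unpickle => // i; case: asboolP => // Pi Fix; exists i.
apply: bigcupT_measurable => n; rewrite /G; case: unpickle => // i.
by case: ifP.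
Qed.

(** The measurable sets are those of the product sigma-algebra, so topology has to be linked to it.
    Balls of the sup norm are boxes, hence measurable, and [U] is the union of the countably many
    balls [B q] with rational centre and radius 1/(n+1) that it contains. *)
Lemma open_measurable3 (U : set V) : open U -> measurable (U : set (M * M * M)).
Proof.
move=> oU.
pose B (q : rat * rat * rat * nat) : set V :=
  ball ((ratr q.1.1.1, ratr q.1.1.2, ratr q.1.2) : V) (q.2.+1%:R^-1).
have -> : U = \bigcup_(q in [set q | B q `<=` U]) B q.
  apply/seteqP; split => [x Ux|x [q + Bx]]; last exact.
  have /nbhs_ballP[e /= e0 xeU] := open_nbhs_nbhs (conj oU Ux).
  have e20 : 0 < e / 2 by rewrite divr_gt0.
  have [n _ /(_ n (leqnn n)) /= ne] := near_infty_natSinv_lt (PosNum e20).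
  have {}ne : n.+1%:R^-1 < e / 2 := ne.
  have r (t : R) : exists q : rat, ball (ratr q : R) n.+1%:R^-1 t.
    have /rat_in_itvoo[q] : t - n.+1%:R^-1 < t + n.+1%:R^-1.
      by rewrite ltrBlDr -addrA ltrDl addr_gt0.
    rewrite in_itv/= => /andP[q1 q2]; exists q.
    by rewrite /ball/= ltr_distl; rewrite q1 q2.
  have [q1 hq1] := r x.1.1; have [q2 hq2] := r x.1.2; have [q3 hq3] := r x.2.
  have Bx : B (q1, q2, q3, n) x by split => //; split.
  exists (q1, q2, q3, n) => // y By; apply: xeU.
  (* Both [x] and [y] lie in the chosen ball, so they are less than 2/(n+1) < e apart. *)
  apply: (@le_ball _ _ _ (n.+1%:R^-1 + n.+1%:R^-1)).
    by rewrite (splitr e) lerD// ltW.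
  exact: (ball_triangle (ball_sym Bx) By).
apply: bigcup_countType_measurable => q.
have -> : B q = (ball (ratr q.1.1.1 : R) q.2.+1%:R^-1 `*`
  ball (ratr q.1.1.2 : R) q.2.+1%:R^-1) `*` ball (ratr q.1.2 : R) q.2.+1%:R^-1 by [].
apply: measurableX; first apply: measurableX; exact: measurable_ball.
Qed.

Lemma continuous_measurable_fun3 (f : V -> R) : continuous f ->
  measurable_fun (setT : set (M * M * M)) (f : M * M * M -> R).
Proof.
move=> /continuousP cf; apply: (measurability _ (RGenOpens.measurableE R)).
move=> _ [_ [a [b ->] <-]]; rewrite setTI; apply: open_measurable3.
exact/cf/interval_open.
Qed.

Lemma measurable_field_components (D : set V) (u : V -> V) :
  measurable_field D u ->
  [/\ measurable_fun (D : set (M * M * M)) (fun x : M * M * M => (u x).1.1 : R),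
      measurable_fun (D : set (M * M * M)) (fun x : M * M * M => (u x).1.2 : R) &
      measurable_fun (D : set (M * M * M)) (fun x : M * M * M => (u x).2 : R)].
Proof.
move=> mu.
have mu1 : measurable_fun (D : set (M * M * M)) (fun x : M * M * M => (u x).1 : (R * R)%type).
  exact: (measurableT_comp measurable_fst mu).
split.
- exact: (measurableT_comp measurable_fst mu1).
- exact: (measurableT_comp measurable_snd mu1).
- exact: (measurableT_comp measurable_snd mu).
Qed.

Lemma continuous_proj11 : continuous (fun y : V => y.1.1).
Proof.
move=> x; apply: (@continuous_comp V (R * R)%type R fst fst x); exact: cvg_fst.
Qed.

Lemma continuous_proj12 : continuous (fun y : V => y.1.2).
Proof.
move=> x; apply: (@continuous_comp V (R * R)%type R fst snd x).
  exact: cvg_fst.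
exact: cvg_snd.
Qed.

Lemma continuous_proj2 : continuous (fun y : V => y.2).
Proof. by move=> x; exact: cvg_snd. Qed.

Lemma continuous_measurable_field (u : V -> V) : continuous u -> measurable_field setT u.
Proof.
move=> cu.
have -> : u = (fun x => ((u x).1.1, (u x).1.2, (u x).2)).
  by apply/funext => x; case: (u x) => [[]].
have c1 : continuous (fun x : V => (u x).1.1).
  by move=> x; apply: (@continuous_comp V V R u (fun y : V => y.1.1) x (cu x));
    exact: continuous_proj11.
have c2 : continuous (fun x : V => (u x).1.2).
  by move=> x; apply: (@continuous_comp V V R u (fun y : V => y.1.2) x (cu x));
    exact: continuous_proj12.
have c3 : continuous (fun x : V => (u x).2).
  by move=> x; apply: (@continuous_comp V V R u (fun y : V => y.2) x (cu x));
    exact: continuous_proj2.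
apply: measurable_fun_pair; [apply: measurable_fun_pair|];
  exact: continuous_measurable_fun3.
Qed.
End measurability3.

(** * Operations that preserve smoothness, and the chain rule for them *)

Section smooth_fields.
Context {R : realType}.
Local Notation V := (R * R * R)%type.
Implicit Types (f g phi : V -> V).

(** The chain rule, with linearity as a hypothesis so that it applies directly to plain functions
    such as coordinates and vector products. *)
Lemma derive_linear_comp (U W W' : normedModType R) (L : W -> W') (f : U -> W)
    (v x : U) : linear L -> continuous L -> differentiable f x ->
  differentiable (L \o f) x /\ 'D_v (L \o f) x = L ('D_v f x).
Proof.
move=> linL cL df.
pose L' : {linear W -> W'} := HB.pack_for {linear W -> W'} L (GRing.isLinear.Build R W W' *:%R L linL).
have cL' : continuous L' by [].
have dL y : differentiable L' y by exact: linear_differentiable.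
have dLf : differentiable (L' \o f) x by apply: differentiable_comp.
split => //.
rewrite (deriveE v df) (deriveE v dLf) (diff_comp df (dL _)) [LHS]/=.
by rewrite (diff_lin (f x) cL').
Qed.

Lemma smooth_linear_comp (L : V -> V) phi : linear L -> continuous L ->
  smooth phi -> smooth (L \o phi).
Proof.
move=> linL cL sphi dirs.
have -> : foldr (fun d f => 'D_d f) (L \o phi) dirs =
          L \o foldr (fun d f => 'D_d f) phi dirs.
  elim: dirs => //= d dirs ->; apply/funext => x.
  exact: (derive_linear_comp d linL cL (sphi dirs x)).2.
by move=> x; exact: (derive_linear_comp 0 linL cL (sphi dirs x)).1.
Qed.

Lemma smoothD f g : smooth f -> smooth g -> smooth (f \+ g).
Proof.
move=> sf sg dirs.
have -> : foldr (fun d f => 'D_d f) (f \+ g) dirs =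
  foldr (fun d f => 'D_d f) f dirs \+ foldr (fun d f => 'D_d f) g dirs.
  elim: dirs => //= d dirs ->; apply/funext => x.
  by rewrite deriveD//; apply: diff_derivable; [exact: sf|exact: sg].
by move=> x; apply: differentiableD; [exact: sf|exact: sg].
Qed.

(** [foldr] applies the last listed direction first, so an extra innermost derivative is an extra
    direction at the end of the list. *)
Lemma smooth_derive f d : smooth f -> smooth ('D_d f).
Proof. by move=> sf dirs; have := sf (rcons dirs d); rewrite -cats1 foldr_cat. Qed.

Lemma smooth_differentiable f x : smooth f -> differentiable f x.
Proof. by move=> sf; exact: (sf [::]). Qed.

Lemma smooth_continuous f : smooth f -> continuous f.
Proof. by move=> sf x; apply: differentiable_continuous; exact: smooth_differentiable. Qed.

Lemma derive_affine (W : normedModType R) (f : V -> W) (l : R) (b v x : V) :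
  differentiable f (affine3 l b x) ->
  differentiable (f \o affine3 l b) x /\
  'D_v (f \o affine3 l b) x = l *: 'D_v f (affine3 l b x).
Proof.
move=> df.
have dA : is_diff x (affine3 l b) ( *:%R l).
  rewrite /affine3.
  have h : is_diff x (( *:%R l : V -> V) + cst b) ( *:%R l + 0) by exact: is_diffD.
  by rewrite addr0 in h.
have [dA1 dA2] := dA.
have dfA : differentiable (f \o affine3 l b) x by apply: differentiable_comp.
split => //.
rewrite (deriveE v dfA) (diff_comp dA1 df) [LHS]/=.
have -> : 'd (affine3 l b) x v = l *: v by rewrite dA2.
by rewrite linearZ (deriveE v df).
Qed.

Lemma smooth_affine phi (l : R) (b : V) : smooth phi -> smooth (phi \o affine3 l b).
Proof.
move=> sphi dirs.
(* Each derivative brings out one factor [l], whence the exponent [size dirs]. *)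
have -> : foldr (fun d f => 'D_d f) (phi \o affine3 l b) dirs =
   (fun x => l ^+ size dirs *: x) \o (foldr (fun d f => 'D_d f) phi dirs \o affine3 l b).
  elim: dirs => [|d dirs IH] /=.
    by apply/funext => x /=; rewrite expr0 scale1r.
  rewrite IH; apply/funext => x.
  have [d1 d2] := derive_affine d (sphi dirs (affine3 l b x)).
  have [||_ ->] := derive_linear_comp (L := fun x : V => l ^+ size dirs *: x) d _ _ d1.
  - by move=> k u w; rewrite scalerDr !scalerA mulrC.
  - by move=> y; apply: cvgZ; [exact: cvg_cst|exact: cvg_id].
  - by rewrite d2 scalerA -exprSr.
move=> x.
have [d1 d2] := derive_affine 0 (sphi dirs (affine3 l b x)).
have [||//] := derive_linear_comp (L := fun x : V => l ^+ size dirs *: x) 0 _ _ d1.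
- by move=> k u w; rewrite scalerDr !scalerA mulrC.
- by move=> y; apply: cvgZ; [exact: cvg_cst|exact: cvg_id].
Qed.
End smooth_fields.

(** * The curl as a linear expression in the derivatives, and supports *)

Section test_fields.
Context {R : realType}.
Local Notation V := (R * R * R)%type.
Local Notation M := (measurableTypeR R).
Implicit Types (f g phi : V -> V) (Omega K : set V).

(** The vector product. The curl is the sum over the basis of [cross3 e_i] applied to the derivative
    along [e_i], so its smoothness reduces to that of linear images of derivatives. *)
Definition cross3 (a d : V) : V :=
  (a.1.2 * d.2 - a.2 * d.1.2, a.2 * d.1.1 - a.1.1 * d.2,
   a.1.1 * d.1.2 - a.1.2 * d.1.1).

Lemma cross3_linear a : linear (cross3 a).
Proof.
move=> k u v; have sE (x y : R) : x *: y = x * y by [].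
by congr (_, _, _) => /=; rewrite !sE; ring.
Qed.

Lemma cross3_continuous a : continuous (cross3 a).
Proof.
move=> x.
have c1 : (fun y : V => y.1.1) @ x --> x.1.1 by exact: continuous_proj11.
have c2 : (fun y : V => y.1.2) @ x --> x.1.2 by exact: continuous_proj12.
have c3 : (fun y : V => y.2) @ x --> x.2 by exact: continuous_proj2.
have h (k l : R) (f1 f2 : V -> R) (l1 l2 : R) : f1 @ x --> l1 -> f2 @ x --> l2 ->
    (fun y => k * f1 y - l * f2 y) @ x --> k * l1 - l * l2.
  by move=> ? ?; apply: cvgB; apply: cvgM => //; exact: cvg_cst.
exact: (cvg_pair (cvg_pair (h a.1.2 a.2 _ _ _ _ c3 c2) (h a.2 a.1.1 _ _ _ _ c1 c3))
  (h a.1.1 a.1.2 _ _ _ _ c2 c1)).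
Qed.

Lemma curl_cross3 phi : curl phi =
  (cross3 (1, 0, 0) \o 'D_(1, 0, 0) phi) \+
  (cross3 (0, 1, 0) \o 'D_(0, 1, 0) phi) \+
  (cross3 (0, 0, 1) \o 'D_(0, 0, 1) phi).
Proof.
have E (d1 d2 d3 : V) : (d2.2 - d3.1.2, d3.1.1 - d1.2, d1.1.2 - d2.1.1) =
    cross3 (1, 0, 0) d1 + cross3 (0, 1, 0) d2 + cross3 (0, 0, 1) d3.
  by congr (_, _, _) => /=; ring.
by apply/funext => x; exact: E.
Qed.

Lemma smooth_curl phi : smooth phi -> smooth (curl phi).
Proof.
move=> sphi; rewrite curl_cross3.
have s a d : smooth (cross3 a \o 'D_d phi).
  apply: smooth_linear_comp; [exact: cross3_linear|exact: cross3_continuous|].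
  exact: smooth_derive.
by do ![apply: smoothD => //].
Qed.

Lemma derive_notin_support (W : normedModType R) (f : V -> W) (d x : V) :
  ~ closure [set x | f x != 0] x -> 'D_d f x = 0.
Proof.
move=> nx.
have [U Ux Uf] : exists2 U, nbhs x U & forall y, U y -> f y = 0.
  apply: contrapT => h; apply: nx => U Ux.
  apply: contrapT => e; apply: h; exists U => // y Uy.
  by apply/eqP/negP => /negP fy; apply: e; exists y.
have -> : 'D_d f x = 'D_d (cst 0) x.
  (* Locality of the derivative is applied in a nonzero direction; along 0 both derivatives
     vanish. *)
  have [->|d0] := eqVneq d 0; first by rewrite !derive0.
  apply: near_eq_derive => //.
  exact: filterS Ux.
by rewrite derive_cst.
Qed.

Lemma support_curl phi :
  closure [set x | curl phi x != 0] `<=` closure [set x | phi x != 0].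
Proof.
rewrite [X in _ `<=` X](closure_id _).1; last exact: closed_closure.
apply: closureS => x /eqP cx; apply: contrapT => nx; apply: cx.
by rewrite /curl !derive_notin_support//= subrr.
Qed.

Lemma test_field_curl Omega phi : test_field Omega phi -> test_field Omega (curl phi).
Proof.
move=> [s c i]; split; first exact: smooth_curl.
  apply: subclosed_compact c _; first exact: closed_closure.
  exact: support_curl.
by move=> x /support_curl /i.
Qed.

Lemma test_fieldW Omega Omega' phi : Omega `<=` Omega' ->
  test_field Omega phi -> test_field Omega' phi.
Proof. by move=> sub [s c i]; split => //; move=> x /i /sub. Qed.

Lemma support_linear_comp (L : V -> V) phi : L 0 = 0 ->
  closure [set x | (L \o phi) x != 0] `<=` closure [set x | phi x != 0].
Proof.
move=> L0; apply: closureS => x /=; apply: contra_neq => ->; exact: L0.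
Qed.

Lemma test_fieldN Omega phi : test_field Omega phi -> test_field Omega (\- phi).
Proof.
have -> : \- phi = (fun x : V => - x) \o phi by [].
move=> [s c i].
have sub := @support_linear_comp (fun x : V => - x) phi (oppr0 _).
split.
- apply: smooth_linear_comp => //.
  + by move=> k u v; rewrite opprD scalerN.
  + exact: opp_continuous.
- apply: subclosed_compact c sub; exact: closed_closure.
- by move=> x /sub /i.
Qed.

Lemma compact_measurable3 K : compact K -> measurable (K : set (M * M * M)).
Proof.
move=> cK; rewrite -[K]setCK; apply: measurableC; apply: open_measurable3.
by apply: closed_openC; apply: compact_closed => //; exact: norm_hausdorff.
Qed.

Lemma compact_supported_bounded (f : V -> R) K : continuous f -> compact K ->
  (forall x, ~ K x -> f x = 0) -> exists B, 0 < B /\ forall x, `|f x| <= B.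
Proof.
move=> cf cK fK.
have : compact (f @` K) by apply: continuous_compact => //; exact: continuous_subspaceT.
move=> /compact_bounded /pinfty_ex_gt0[B B0 hB]; exists B; split => // x.
have [Kx|/fK ->] := pselect (K x); last by rewrite normr0 ltW.
by apply: hB; exists x.
Qed.
End test_fields.

(** * Integrability under compact support, and difference quotients *)

Section compact_support.
Context {R : realType}.
Local Notation V := (R * R * R)%type.
Local Notation M := (measurableTypeR R).
Implicit Types (f g : V -> R) (K D : set V).

Lemma compact_vol_lty K : compact K -> (vol (K : set (M * M * M)) < +oo)%E.
Proof.
move=> cK; have [B B0 KB] := pinfty_ex_gt0 (compact_bounded cK).
pose I : set M := `[- B, B]%classic.
have mI : measurable I by exact: measurable_itv.
have KI : (K : set (M * M * M)) `<=` (I `*` I) `*` I.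
  move=> x Kx; have := KB _ Kx; rewrite /Num.norm/= ge_max => /andP[].
  rewrite /Num.norm/= ge_max => /andP[x1 x2] x3.
  by do 2?split; rewrite /I/= in_itv/= -ler_norml.
have leI : (lebesgue_measure I < +oo)%E.
  by rewrite lebesgue_measure_itv/=; case: ifP => // _; rewrite -EFinB ltry.
apply: (@le_lt_trans _ _ (vol ((I `*` I) `*` I))).
  apply: le_measure => //; rewrite inE; first exact: compact_measurable3.
  by apply: measurableX => //; exact: measurableX.
have -> : vol ((I `*` I) `*` I) =
    (lebesgue_measure I * lebesgue_measure I * lebesgue_measure I)%E.
  transitivity ((@lebesgue_measure R \x @lebesgue_measure R) (I `*` I) *
      lebesgue_measure I)%E.
    by apply: product_measure1E => //; exact: measurableX.
  by rewrite product_measure1E.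
by rewrite lte_mul_pinfty// ?ge0_fin_numE// ?mule_ge0// lte_mul_pinfty// ge0_fin_numE.
Qed.

(** Restricting [h] to [D] or to [K] gives the same function, so integrability on [K] suffices,
    where [g] dominates. It is used with [g] constant and with [g] a multiple of the norm of a
    locally integrable field. *)
Lemma integrable_compact_supported_le D K (h g : M * M * M -> R) :
  measurable (D : set (M * M * M)) -> compact K -> K `<=` D ->
  measurable_fun (D : set (M * M * M)) h ->
  measurable_fun (D : set (M * M * M)) g ->
  (\int[vol]_(x in K) (g x)%:E < +oo)%E -> (forall x, 0 <= g x) ->
  (forall x, K x -> `|h x| <= g x) -> (forall x, D x -> ~ K x -> h x = 0) ->
  vol.-integrable (D : set (M * M * M)) (EFin \o h).
Proof.
move=> mD cK KD mh mg goo g0 hg h0.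
have mK := compact_measurable3 cK.
have iK : vol.-integrable (K : set (M * M * M)) (EFin \o h).
  apply/integrableP; split.
    apply/measurable_EFinP; exact: (measurable_funS mD KD mh).
  apply: le_lt_trans goo; apply: ge0_le_integral => //.
  - apply/measurable_EFinP/measurableT_comp => //; exact: (measurable_funS mD KD mh).
  - by apply/measurable_EFinP; exact: (measurable_funS mD KD mg).
have e : (EFin \o h) \_ D = (EFin \o h) \_ K.
  apply/funext => x; rewrite !patchE.
  have [Kx|Kx] := pselect (K x).
    by rewrite !mem_set//; exact: KD.
  rewrite (memNset Kx); case: ifPn => //; rewrite inE => Dx.
  by rewrite /= h0.
by apply/(integrable_mkcond _ mD); rewrite e; apply/(integrable_mkcond _ mK).
Qed.

Lemma integrable_compact_supported f K : continuous f -> compact K ->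
  (forall x, ~ K x -> f x = 0) -> vol.-integrable (setT : set (M * M * M)) (EFin \o f).
Proof.
move=> cf cK fK; have [B [B0 fB]] := compact_supported_bounded cf cK fK.
apply: (@integrable_compact_supported_le setT K f (cst B)) => //.
- exact: continuous_measurable_fun3.
- have iB : (\int[vol]_(x in K) B%:E = B%:E * vol K)%E.
    exact: (integral_cst vol (compact_measurable3 cK) B%:E).
  rewrite /cst iB.
  by rewrite lte_mul_pinfty// ?lee_fin ?ltW// compact_vol_lty.
- by move=> x /=; exact: ltW.
- by move=> x _; exact: fK.
Qed.

Lemma line_derive g (e x : V) (t : R) : differentiable g (t *: e + x) ->
  is_derive t 1 (fun s : R => g (s *: e + x)) ('D_e g (t *: e + x)).
Proof.
move=> dg.
have dl : is_diff t ( *:%R ^~ e + cst x : R -> V) ( *:%R ^~ e).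
  have h : is_diff t ( *:%R ^~ e + cst x : R -> V) ( *:%R ^~ e + 0) by exact: is_diffD.
  by rewrite addr0 in h.
have [dl1 dl2] := dl.
have dgl : differentiable (g \o ( *:%R ^~ e + cst x : R -> V)) t.
  exact: differentiable_comp.
apply: DeriveDef; first exact: diff_derivable dgl.
rewrite (deriveE _ dgl) (diff_comp dl1 dg) [LHS]/= dl2 (deriveE _ dg) /=.
by rewrite scale1r.
Qed.

(** The mean value theorem on the line through [x] along [e]. Since the bound does not depend on
    [h], it serves for dominated convergence. *)
Lemma diff_quotient_le g (e x : V) (B h : R) : 0 < h ->
  (forall y, differentiable g y) -> (forall y, `|'D_e g y| <= B) ->
  `|h^-1 * (g (h *: e + x) - g x)| <= B.
Proof.
move=> h0 dg gB.
have dl t := line_derive (dg (t *: e + x)).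
have [|c _] := @MVT_segment R (fun s : R => g (s *: e + x))
  (fun s => 'D_e g (s *: e + x)) 0 h (ltW h0) (fun t _ => dl t).
  apply: continuous_subspaceT => t.
  have [d _] := dl t; apply: differentiable_continuous; exact/derivable1_diffP.
rewrite scale0r add0r subr0 => ->.
by rewrite mulrCA mulVf ?gt_eqF// mulr1.
Qed.

Lemma diff_quotient_cvg g (e x : V) : differentiable g x ->
  (fun n => n.+1%:R * (g (n.+1%:R^-1 *: e + x) - g x)) @ \oo --> 'D_e g x.
Proof.
move=> dg.
have dd := @diff_derivable _ _ _ g x e dg.
have c : (fun h : R => h^-1 *: (g (h *: e + x) - g x)) @ 0^' --> 'D_e g x by exact: dd.
(* The derivative is a limit along punctured neighbourhoods of 0, so the steps 1/(n+1) must also be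
   nonzero. *)
have h0 : (fun n : nat => n.+1%:R^-1 : R) @ \oo --> 0^'.
  move=> A [eps /= eps0 hA].
  have [N _ hN] := near_infty_natSinv_lt (PosNum eps0).
  exists N => // n Nn; apply: hA; last by rewrite /= invr_eq0 pnatr_eq0.
  rewrite /ball/= sub0r normrN ger0_norm//; exact: hN.
have := cvg_comp _ _ h0 c; apply: cvg_trans; apply: near_eq_cvg; near=> n.
by rewrite /= invrK.
Unshelve. all: end_near.
Qed.
End compact_support.

(** * Integration by parts for compactly supported functions on R^3 *)

Section integration_by_parts.
Context {R : realType}.
Local Notation V := (R * R * R)%type.
Local Notation M := (measurableTypeR R).
Implicit Types (f g : V -> R) (K : set V).

(* Integration by parts is the limit of the discrete identity
   [int f (tau_h g - g) = int g (tau_(-h) f - f)], which is translation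
   invariance; no product rule and no iterated integral is needed. *)
Lemma integral_diff_quotient_cvg f g (e : V) K : compact K ->
  continuous f -> (forall x, ~ K x -> f x = 0) ->
  (forall x, differentiable g x) -> continuous ('D_e g) ->
  (forall x, ~ K x -> g x = 0) ->
  (fun n => \int[vol]_x
    (f x * (n.+1%:R * (g (n.+1%:R^-1 *: e + x) - g x)))%:E)%E @ \oo -->
  (\int[vol]_x (f x * 'D_e g x)%:E)%E.
Proof.
move=> cK cf fK dg cDg gK.
have clK : closed K by apply: compact_closed => //; exact: norm_hausdorff.
have DgK x : ~ K x -> 'D_e g x = 0.
  move=> Kx; apply: derive_notin_support; apply: contra_not Kx.
  rewrite (closure_id K).1//; apply: closureS => y /= /eqP gy.
  by apply: contrapT => /gK.
have [B [B0 gB]] := compact_supported_bounded cDg cK DgK.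
have cg : continuous g by move=> x; exact: differentiable_continuous.
have cs (n : nat) : continuous (fun x : V => n.+1%:R * (g (n.+1%:R^-1 *: e + x) - g x)).
  move=> x; apply: cvgM; first exact: cvg_cst.
  apply: cvgB; last exact: cg.
  apply: (@continuous_comp V V R (fun y : V => n.+1%:R^-1 *: e + y) g x); last exact: cg.
  by apply: cvgD; [exact: cvg_cst|exact: cvg_id].
have mf := continuous_measurable_fun3 cf.
pose f_ n (x : M * M * M) := (f x * (n.+1%:R * (g (n.+1%:R^-1 *: e + x) - g x)))%:E.
have mf_ n : measurable_fun setT (f_ n).
  apply/measurable_EFinP; apply: measurable_funM => //.
  exact: continuous_measurable_fun3 (cs n).
have mfl : measurable_fun setT (fun x : M * M * M => (f x * 'D_e g x)%:E).
  apply/measurable_EFinP; apply: measurable_funM => //.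
  exact: continuous_measurable_fun3.
have f_cvg : {ae vol, forall x, setT x -> f_ ^~ x @ \oo --> (f x * 'D_e g x)%:E}.
  apply: nearW => x _; apply: cvg_EFin; first exact: nearW.
  by apply: cvgM; [exact: cvg_cst|exact: diff_quotient_cvg].
have ifB : vol.-integrable setT (fun x : M * M * M => (`|f x| * B)%:E).
  apply: (@integrable_compact_supported _ (fun x => `|f x| * B) K) => //.
    move=> x; apply: cvgM; last exact: cvg_cst.
    apply: (@continuous_comp V R R f Num.norm x); first exact: cf.
    exact: norm_continuous.
  by move=> x /fK ->; rewrite normr0 mul0r.
have f_le : {ae vol, forall x n, setT x -> (`|f_ n x| <= (`|f x| * B)%:E)%E}.
  apply: nearW => x n _; rewrite /= lee_fin normrM ler_wpM2l//.
  by have := @diff_quotient_le R g e x B n.+1%:R^-1; rewrite invrK; apply.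
by have [_ _] := dominated_convergence measurableT mf_ mfl f_cvg ifB f_le.
Qed.

(** The integrand is the Leibniz expansion of the derivative of [f g]. Integrability and the zero
    value are stated together so that several instances can be added up. *)
Lemma integral_by_parts f g (e : V) K : compact K ->
  (forall x, differentiable f x) -> continuous ('D_e f) ->
  (forall x, ~ K x -> f x = 0) ->
  (forall x, differentiable g x) -> continuous ('D_e g) ->
  (forall x, ~ K x -> g x = 0) ->
  vol.-integrable setT (fun x : M * M * M => (f x * 'D_e g x + g x * 'D_e f x)%:E) /\
  \int[vol]_x (f x * 'D_e g x + g x * 'D_e f x) = 0.
Proof.
move=> cK df cDf fK dg cDg gK.
have cf : continuous f by move=> x; exact: differentiable_continuous.
have cg : continuous g by move=> x; exact: differentiable_continuous.
have ics (h k : V -> R) : continuous h -> continuous k ->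
    (forall x, ~ K x -> h x = 0) ->
    vol.-integrable setT (EFin \o (fun x : M * M * M => h x * k x)).
  move=> ch ck hK; apply: (@integrable_compact_supported _ _ K) => //.
    by move=> x; apply: cvgM; [exact: ch|exact: ck].
  by move=> x /hK ->; rewrite mul0r.
have i1 := ics _ _ cf cDg fK.
have i2 := ics _ _ cg cDf gK.
split; first exact: (integrableD measurableT i1 i2).
rewrite (RintegralD measurableT i1 i2); apply/eqP; rewrite addr_eq0; apply/eqP.
have l1 := integral_diff_quotient_cvg cK cf fK dg cDg gK.
(* The translate falls on [f] with the opposite shift, so its quotient converges to the derivative
   along [- e]. *)
have DNf : 'D_(- e) f = \- 'D_e f.
  apply/funext => x; rewrite [RHS]/= (deriveE _ (df x)) (deriveE _ (df x)); exact: linearN.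
have cDNf : continuous ('D_(- e) f).
  by rewrite DNf => x; apply: cvgN; exact: cDf.
have l2 := integral_diff_quotient_cvg cK cg gK df cDNf fK.
have ics3 (h k : V -> R) (b : V) (hh : continuous h) (kk : continuous k)
    (hK : forall x, ~ K x -> h x = 0) :
    vol.-integrable setT (EFin \o (fun x : M * M * M => h x * k (b + x))).
  apply: ics => // x; apply: (@continuous_comp V V R (fun y : V => b + y) k x); last exact: kk.
  by apply: cvgD; [exact: cvg_cst|exact: cvg_id].
have expand (h k : V -> R) (b : V) (c : R) (hh : continuous h) (kk : continuous k)
    (hK : forall x, ~ K x -> h x = 0) :
    (\int[vol]_x (h x * (c * (k (b + x) - k x)))%:E =
    (c * (\int[vol]_x (h x * k (b + x)) - \int[vol]_x (h x * k x)))%:E)%E.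
  have I1 := ics3 h k b hh kk hK; have I2 := ics h k hh kk hK.
  have I3 : vol.-integrable setT
      (EFin \o (fun x : M * M * M => h x * k (b + x) - h x * k x)).
    exact: (integrableB measurableT I1 I2).
  rewrite -(RintegralB measurableT I1 I2) -(RintegralZl c measurableT I3).
  rewrite /Rintegral fineK.
    by apply: eq_integral => x _; congr EFin; ring.
  apply: (integrable_fin_num measurableT).
  exact: (integrableZl measurableT c I3).
(* The two sequences of integrals agree term by term: shifting by [e]/(n+1), which is
   [Rintegral_affine] with factor 1, moves the translate from [g] to [f]. Hence their limits
   agree. *)
have E : (\int[vol]_x (f x * 'D_e g x)%:E = \int[vol]_x (g x * 'D_(- e) f x)%:E)%E.
  apply: (cvg_unique _ l1).
    exact: ereal_hausdorff.
  apply: cvg_trans l2; apply: near_eq_cvg; apply: nearW => n.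
  rewrite (expand g f)// (expand f g)//; congr (_ * (_ - _))%:E.
    have := Rintegral_affine (n.+1%:R^-1 *: e) ltr01 (ics3 g f (n.+1%:R^-1 *: - e) cg cf gK).
    rewrite expr1n mul1r => ->; apply: eq_Rintegral => x _.
    by rewrite /affine3 scale1r scalerN addrCA addNr addr0 mulrC [X in _ = _ * g X]addrC.
  by apply: eq_Rintegral => x _; rewrite mulrC.
transitivity (\int[vol]_x (g x * 'D_(- e) f x)); first by rewrite /Rintegral E.
rewrite -[RHS]mulN1r; transitivity (\int[vol]_x (-1 * (g x * 'D_e f x))); last first.
  exact: (RintegralZl _ measurableT i2).
apply: eq_Rintegral => x _.
have -> : 'D_(- e) f x = - 'D_e f x by exact: (congr1 (fun h : V -> R => h x) DNf).
by rewrite mulN1r mulrN.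
Qed.
End integration_by_parts.

(** * The curl is self-adjoint on test fields *)

Section curl_selfadjoint.
Context {R : realType}.
Local Notation V := (R * R * R)%type.
Local Notation M := (measurableTypeR R).
Implicit Types (phi psi u v : V -> V) (K Omega : set V).

Lemma dot3_continuous u v : continuous u -> continuous v ->
  continuous (fun x => dot3 (u x) (v x)).
Proof.
move=> cu cv x.
have c1 (w : V -> V) : continuous w -> (fun x => (w x).1.1) @ x --> (w x).1.1.
  move=> cw; apply: (@continuous_comp V V R w (fun y : V => y.1.1) x (cw x)).
  exact: continuous_proj11.
have c2 (w : V -> V) : continuous w -> (fun x => (w x).1.2) @ x --> (w x).1.2.
  move=> cw; apply: (@continuous_comp V V R w (fun y : V => y.1.2) x (cw x)).
  exact: continuous_proj12.
have c3 (w : V -> V) : continuous w -> (fun x => (w x).2) @ x --> (w x).2.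
  move=> cw; apply: (@continuous_comp V V R w (fun y : V => y.2) x (cw x)).
  exact: continuous_proj2.
by apply: cvgD; [apply: cvgD|]; apply: cvgM; (apply: c1 || apply: c2 || apply: c3).
Qed.

Lemma dot3_measurable (D : set V) u v : measurable (D : set (M * M * M)) ->
  measurable_field D u -> measurable_field D v ->
  measurable_fun (D : set (M * M * M)) (fun x : M * M * M => dot3 (u x) (v x)).
Proof.
move=> mD /measurable_field_components[u1 u2 u3] /measurable_field_components[v1 v2 v3].
by apply: measurable_funD; [apply: measurable_funD|]; apply: measurable_funM.
Qed.

Lemma dot3_0l (a : V) : dot3 0 a = 0.
Proof. by rewrite /dot3 /= !mul0r !addr0. Qed.

Lemma dot3C (a b : V) : dot3 a b = dot3 b a.
Proof. by rewrite /dot3; ring. Qed.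

Lemma notin_support phi x : ~ closure [set x | phi x != 0] x -> phi x = 0.
Proof.
by move=> nx; apply/eqP/negP => /negP px; apply: nx; exact: subset_closure.
Qed.

Lemma test_field_continuous Omega phi : test_field Omega phi -> continuous phi.
Proof. by case=> s _ _; exact: smooth_continuous. Qed.

Lemma integrable_dot3_test_fields Omega phi psi :
  test_field Omega phi -> continuous psi ->
  vol.-integrable setT (EFin \o (fun x : M * M * M => dot3 (phi x) (psi x))).
Proof.
move=> tphi cpsi; have [_ cK _] := tphi.
apply: (integrable_compact_supported _ cK).
  exact: dot3_continuous (test_field_continuous tphi) cpsi.
by move=> x /notin_support ->; rewrite dot3_0l.
Qed.

Let zero_integral (h : M * M * M -> R) :=
  vol.-integrable setT (EFin \o h) /\ \int[vol]_x h x = 0.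

Let zero_integralD h k : zero_integral h -> zero_integral k ->
  zero_integral (fun x => h x + k x).
Proof.
move=> [ih h0] [ik k0]; split; first exact: (integrableD measurableT ih ik).
by rewrite (RintegralD measurableT ih ik) h0 k0 addr0.
Qed.

Let zero_integralB h k : zero_integral h -> zero_integral k ->
  zero_integral (fun x => h x - k x).
Proof.
move=> [ih h0] [ik k0]; split; first exact: (integrableB measurableT ih ik).
by rewrite (RintegralB measurableT ih ik) h0 k0 subr0.
Qed.

(** The difference of the integrands is -div(phi x psi), a signed sum of six derivatives of products
    of one component of [phi] and one of [psi]. Each has zero integral by parts; [Z] supplies them
    and [ring] matches the sum. *)
Lemma curl_selfadjoint Omega phi psi : test_field Omega phi -> test_field Omega psi ->
  \int[vol]_x dot3 (phi x) (curl psi x) = \int[vol]_x dot3 (curl phi x) (psi x).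
Proof.
move=> tphi tpsi; have [sphi cphi _] := tphi; have [spsi cpsi _] := tpsi.
pose K := closure [set x | phi x != 0] `|` closure [set x | psi x != 0].
have cK : compact K by exact: compactU.
have phiK x : ~ K x -> phi x = 0.
  by move=> Kx; apply: notin_support => h; apply: Kx; left.
have psiK x : ~ K x -> psi x = 0.
  by move=> Kx; apply: notin_support => h; apply: Kx; right.
have Z (p q : V -> R) (e : V) : linear p -> continuous p -> linear q -> continuous q ->
    zero_integral (fun x => p (phi x) * q ('D_e psi x) + q (psi x) * p ('D_e phi x)).
  move=> lp cp lq cq.
  have comp (r : V -> R) (chi : V -> V) : linear r -> continuous r -> smooth chi ->
      (forall x, ~ K x -> chi x = 0) ->
      [/\ forall x, differentiable (r \o chi) x, 'D_e (r \o chi) = r \o 'D_e chi,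
          continuous ('D_e (r \o chi)) & forall x, ~ K x -> (r \o chi) x = 0].
    move=> lr cr schi chiK.
    have E : 'D_e (r \o chi) = r \o 'D_e chi.
      apply/funext => x.
      exact: (derive_linear_comp e lr cr (smooth_differentiable x schi)).2.
    split => //.
    - move=> x; exact: (derive_linear_comp 0 lr cr (smooth_differentiable x schi)).1.
    - rewrite E => x; apply: (@continuous_comp V V R ('D_e chi) r x); last exact: cr.
      exact: (smooth_continuous (smooth_derive e schi)).
    - move=> x Kx /=; rewrite chiK//.
      (* Linearity at 0 with coefficient -1 reads [r 0 = - r 0 + r 0], so [r 0 = 0]. *)
      have := lr (-1) 0 0; rewrite scaler0 addr0 scaleN1r => h.
      by rewrite h addNr.
  have [d1 E1 c1 k1] := comp p phi lp cp sphi phiK.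
  have [d2 E2 c2 k2] := comp q psi lq cq spsi psiK.
  have Zpq : zero_integral (fun x => (p \o phi) x * 'D_e (q \o psi) x +
      (q \o psi) x * 'D_e (p \o phi) x).
    exact: integral_by_parts cK d1 c1 k1 d2 c2 k2.
  rewrite (_ : (fun x => _) = (fun x => (p \o phi) x * 'D_e (q \o psi) x +
      (q \o psi) x * 'D_e (p \o phi) x))//.
  apply/funext => x; congr (_ * _ + _ * _).
    exact: (esym (congr1 (fun h : V -> R => h x) E2)).
  exact: (esym (congr1 (fun h : V -> R => h x) E1)).
have l1 : linear (fun y : V => y.1.1) by [].
have l2 : linear (fun y : V => y.1.2) by [].
have l3 : linear (fun y : V => y.2) by [].
have c1 := @continuous_proj11 R; have c2 := @continuous_proj12 R.
have c3 := @continuous_proj2 R.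
have [_] := zero_integralB (zero_integralD (zero_integralB (zero_integralD (zero_integralB
  (Z _ _ (0, 1, 0) l1 c1 l3 c3) (Z _ _ (0, 0, 1) l1 c1 l2 c2))
  (Z _ _ (0, 0, 1) l2 c2 l1 c1)) (Z _ _ (1, 0, 0) l2 c2 l3 c3))
  (Z _ _ (1, 0, 0) l3 c3 l2 c2)) (Z _ _ (0, 1, 0) l3 c3 l1 c1).
have cc := test_field_continuous (test_field_curl tpsi).
have i1 := integrable_dot3_test_fields tphi cc.
have i2 := integrable_dot3_test_fields (test_field_curl tphi) (test_field_continuous tpsi).
move=> H; apply/eqP; rewrite -subr_eq0 -(RintegralB measurableT i1 i2); apply/eqP.
apply: etrans H; apply: eq_Rintegral => x _; rewrite /dot3 /curl.
move: ('D_(1, 0, 0) phi x) ('D_(0, 1, 0) phi x) ('D_(0, 0, 1) phi x) => a1 a2 a3.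
move: ('D_(1, 0, 0) psi x) ('D_(0, 1, 0) psi x) ('D_(0, 0, 1) psi x) => b1 b2 b3.
move: (phi x) (psi x) => a b /=; ring.
Qed.
End curl_selfadjoint.

(** * The Euclidean norm, and extension by zero *)

Section euclidean_norm.
Context {R : realType}.
Local Notation V := (R * R * R)%type.
Local Notation M := (measurableTypeR R).
Implicit Types (a b : V) (u v : V -> V) (Omega D : set V).

Lemma dot3_ge0 a : 0 <= dot3 a a.
Proof. by rewrite /dot3 -!expr2 !addr_ge0 ?sqr_ge0. Qed.

Lemma norm3_ge0 a : 0 <= norm3 a.
Proof. exact: sqrtr_ge0. Qed.

Lemma norm3_sqr a : norm3 a ^+ 2 = dot3 a a.
Proof. by rewrite sqr_sqrtr// dot3_ge0. Qed.

Lemma norm3_0 : norm3 (0 : V) = 0.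
Proof. by rewrite /norm3 /dot3 /= !mul0r !addr0 sqrtr0. Qed.

Lemma norm3Z (k : R) a : norm3 (k *: a) = `|k| * norm3 a.
Proof.
have -> : norm3 (k *: a) = Num.sqrt (k ^+ 2 * dot3 a a).
  have sE (x y : R) : x *: y = x * y by [].
  by congr Num.sqrt; rewrite /dot3 /= !sE; ring.
by rewrite sqrtrM ?sqr_ge0// sqrtr_sqr.
Qed.

Lemma cauchy_schwarz3 a b : `|dot3 a b| <= norm3 a * norm3 b.
Proof.
rewrite -(@ler_pXn2r _ 2)// ?nnegrE ?mulr_ge0 ?norm3_ge0//.
rewrite exprMn !norm3_sqr real_normK ?num_real//.
rewrite -subr_ge0.
(* Lagrange's identity: the defect in Cauchy-Schwarz is the squared norm of the vector product. *)
have -> : dot3 a a * dot3 b b - dot3 a b ^+ 2 = (a.1.1 * b.1.2 - a.1.2 * b.1.1) ^+ 2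
    + (a.1.1 * b.2 - a.2 * b.1.1) ^+ 2 + (a.1.2 * b.2 - a.2 * b.1.2) ^+ 2.
  by rewrite /dot3; ring.
by rewrite !addr_ge0 ?sqr_ge0.
Qed.

Lemma ler_norm3D a b : norm3 (a + b) <= norm3 a + norm3 b.
Proof.
rewrite -(@ler_pXn2r _ 2)// ?nnegrE ?addr_ge0 ?norm3_ge0//.
rewrite sqrrD !norm3_sqr.
have -> : dot3 (a + b) (a + b) = dot3 a a + dot3 a b *+ 2 + dot3 b b.
  by rewrite /dot3 /=; ring.
by rewrite lerD2r lerD2l lerMn2r/= (le_trans (ler_norm _))// cauchy_schwarz3.
Qed.

Lemma norm3_measurable D u : measurable (D : set (M * M * M)) ->
  measurable_field D u ->
  measurable_fun (D : set (M * M * M)) (fun x : M * M * M => norm3 (u x)).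
Proof.
move=> mD mu; apply: (measurableT_comp _ (dot3_measurable mD mu mu)).
by apply: continuous_measurable_fun; exact: sqrt_continuous.
Qed.

Lemma norm3_continuous u : continuous u -> continuous (fun x => norm3 (u x)).
Proof.
move=> cu x.
apply: (@continuous_comp V R R (fun x => dot3 (u x) (u x)) (@Num.sqrt R) x).
  exact: dot3_continuous.
exact: sqrt_continuous.
Qed.

Lemma ext0_setT u : ext0 setT u = u.
Proof. by apply/funext => x; rewrite /ext0 /patch mem_set. Qed.

Lemma ext0_in Omega u x : Omega x -> ext0 Omega u x = u x.
Proof. by move=> Ox; rewrite /ext0 /patch mem_set. Qed.

Lemma ext0_notin Omega u x : ~ Omega x -> ext0 Omega u x = 0.
Proof. by move=> Ox; rewrite /ext0 /patch memNset. Qed.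

Lemma ext0_support Omega u : (forall x, ~ Omega x -> u x = 0) -> ext0 Omega u = u.
Proof.
move=> u0; apply/funext => x; have [Ox|Ox] := pselect (Omega x).
  exact: ext0_in.
by rewrite ext0_notin// u0.
Qed.

Lemma ext0_measurable Omega u : measurable (Omega : set (M * M * M)) ->
  measurable_field Omega u -> measurable_field setT (ext0 Omega u).
Proof.
move=> mO mu; rewrite /measurable_field -(setvU Omega).
apply/measurable_funU => //; first exact: measurableC.
split.
  apply: (eq_measurable_fun (cst (0 : V))); last exact: measurable_cst.
  by move=> x; rewrite inE => /ext0_notin ->.
by apply: (eq_measurable_fun u) => // x; rewrite inE => /ext0_in ->.
Qed.
End euclidean_norm.

(** * L^p norms of scalar functions and of vector fields *)

Section Lnorm_real.
Context d (T : measurableType d) (R : realType) (mu : {measure set T -> \bar R}).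
Implicit Types (f g : T -> R) (p : R).
Local Open Scope ereal_scope.

Lemma Lnorm_EFinE p f :
  Lnorm mu p%:E (EFin \o f) = (\int[mu]_x ((`|f x| `^ p)%R)%:E) `^ p^-1.
Proof. by rewrite unlock. Qed.

Lemma measurable_norm_powR p f : measurable_fun setT f ->
  measurable_fun setT (fun x => ((`|f x| `^ p)%R)%:E).
Proof.
move=> mf; apply/measurable_EFinP.
exact/(measurableT_comp (measurable_powR p))/measurableT_comp.
Qed.

Lemma le_Lnorm p f g : (0 < p)%R -> measurable_fun setT f -> measurable_fun setT g ->
  (forall x, `|f x| <= `|g x|)%R -> Lnorm mu p%:E (EFin \o f) <= Lnorm mu p%:E (EFin \o g).
Proof.
move=> p0 mf mg fg; rewrite !Lnorm_EFinE.
apply: gt0_ler_poweR; first by rewrite invr_ge0 ltW.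
- by rewrite in_itv/= leey andbT; apply: integral_ge0 => x _; rewrite lee_fin powR_ge0.
- by rewrite in_itv/= leey andbT; apply: integral_ge0 => x _; rewrite lee_fin powR_ge0.
apply: ge0_le_integral.
- exact: measurableT.
- by move=> x _; rewrite lee_fin powR_ge0.
- exact: measurable_norm_powR.
- exact: measurable_norm_powR.
- by move=> x _; rewrite lee_fin ge0_ler_powR// ?ltW// nnegrE.
Qed.
End Lnorm_real.

Section Lp_norms.
Context {R : realType}.
Local Notation V := (R * R * R)%type.
Local Notation M := (measurableTypeR R).
Implicit Types (u v : V -> V) (Omega D : set V) (p : R).
Local Open Scope ereal_scope.

Lemma Lp_norm_ext0 p Omega u : Lp_norm p Omega u = Lp_norm p setT (ext0 Omega u).
Proof. by rewrite /Lp_norm ext0_setT. Qed.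

Lemma Lp_norm_setT p u :
  Lp_norm p setT u = (\int[vol]_x ((norm3 (u x) `^ p)%R)%:E) `^ p^-1.
Proof.
rewrite /Lp_norm ext0_setT; apply: (etrans (Lnorm_EFinE vol p (fun x => norm3 (u x)))).
have -> // : (fun x : M * M * M => ((`|norm3 (u x)| `^ p)%R)%:E) =
  (fun x => ((norm3 (u x) `^ p)%R)%:E).
by apply/funext => x; rewrite ger0_norm ?norm3_ge0.
Qed.

Lemma Lp_norm_ge0 p Omega u : 0 <= Lp_norm p Omega u.
Proof. exact: Lnorm_ge0. Qed.

Let mpow p u : measurable_field setT u ->
  measurable_fun setT (fun x : M * M * M => ((norm3 (u x) `^ p)%R)%:E).
Proof.
move=> mu; apply/measurable_EFinP.
exact: (measurableT_comp (measurable_powR p) (norm3_measurable measurableT mu)).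
Qed.

Lemma Lp_norm_poweR p u : (0 < p)%R ->
  Lp_norm p setT u `^ p = \int[vol]_x ((norm3 (u x) `^ p)%R)%:E.
Proof.
move=> p0; rewrite Lp_norm_setT -poweRrM mulVf ?gt_eqF// poweRe1//.
by apply: integral_ge0 => x _; rewrite lee_fin powR_ge0.
Qed.

Lemma Lp_norm2_sqr u :
  Lp_norm 2 setT u ^+ 2 = \int[vol]_x (norm3 (u x) ^+ 2)%:E.
Proof.
have -> : Lp_norm 2 setT u ^+ 2 = Lp_norm 2 setT u `^ 2.
  have := Lp_norm_ge0 2 setT u; case: (Lp_norm 2 setT u) => [r|_|//].
    by rewrite lee_fin => r0; rewrite poweR_EFin (powR_mulrn 2 r0) EFin_expe.
  by rewrite expe2 mulyy poweRyr.
rewrite Lp_norm_poweR//; apply: eq_integral => x _.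
by rewrite powR_mulrn// norm3_ge0.
Qed.

(** Rewrites the expression under the infimum of [Scurl_bound] as a squared norm, to which
    Minkowski's inequality and scaling apply; infinite values are included. *)
Lemma Lp_norm6_sqr u : (\int[vol]_x (norm3 (u x) ^+ 6)%:E) `^ 3^-1 =
  Lp_norm 6 setT u ^+ 2.
Proof.
have -> : Lp_norm 6 setT u ^+ 2 = Lp_norm 6 setT u `^ 2.
  have := Lp_norm_ge0 6 setT u; case: (Lp_norm 6 setT u) => [r|_|//].
    by rewrite lee_fin => r0; rewrite poweR_EFin (powR_mulrn 2 r0) EFin_expe.
  by rewrite expe2 mulyy poweRyr.
rewrite Lp_norm_setT -poweRrM; congr (_ `^ _); last by field.
by apply: eq_integral => x _; rewrite powR_mulrn// norm3_ge0.
Qed.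

(** The pointwise triangle inequality reduces this to the scalar Minkowski inequality for
    [norm3 \o u] and [norm3 \o v]. *)
Lemma Lp_normD p u v : (1 <= p)%R -> measurable_field setT u ->
  measurable_field setT v ->
  Lp_norm p setT (u \+ v)%R <= Lp_norm p setT u + Lp_norm p setT v.
Proof.
move=> p1 mu mv.
have nu := norm3_measurable measurableT mu.
have nv := norm3_measurable measurableT mv.
have nuv := measurable_funD nu nv.
rewrite /Lp_norm !ext0_setT.
apply: le_trans (minkowski_EFin vol nu nv p1).
have norm3D_le x : (`|norm3 ((u \+ v) x)%R| <= `|norm3 (u x) + norm3 (v x)|)%R.
  by rewrite !ger0_norm ?addr_ge0 ?norm3_ge0// ler_norm3D.
apply: le_Lnorm nuv norm3D_le; first exact: lt_le_trans p1.
apply: (norm3_measurable measurableT).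
have [u1 u2 u3] := measurable_field_components mu.
have [v1 v2 v3] := measurable_field_components mv.
by do 2?apply: measurable_fun_pair; apply: measurable_funD.
Qed.

Lemma Lp_norm_hoelder u v : measurable_field setT u -> measurable_field setT v ->
  vol.-integrable setT (EFin \o (fun x : M * M * M => dot3 (u x) (v x))) ->
  (`|\int[vol]_x dot3 (u x) (v x)|%R)%:E <= Lp_norm 2 setT u * Lp_norm 2 setT v.
Proof.
move=> mu mv iuv.
have nu := norm3_measurable measurableT mu.
have nv := norm3_measurable measurableT mv.
have nuv := measurable_funM nu nv.
have muv : measurable_fun setT (EFin \o (fun x : M * M * M => dot3 (u x) (v x))).
  by case/integrableP: iuv.
rewrite /Lp_norm !ext0_setT (EFin_normr_Rintegral measurableT iuv).
have pq : (2^-1 + 2^-1 = 1 :> R)%R by field.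
apply: le_trans (hoelder vol nu nv (ltr0n _ 2) (ltr0n _ 2) pq).
rewrite Lnorm1; apply: le_trans (le_abse_integral vol measurableT muv) _.
apply: ge0_le_integral.
- exact: measurableT.
- by move=> x _; exact: abse_ge0.
- exact: measurableT_comp.
- by apply: measurableT_comp => //; apply/measurable_EFinP.
- move=> x _; rewrite /= lee_fin.
  by rewrite (le_trans (cauchy_schwarz3 _ _))// ler_norm.
Qed.

Lemma Lp_norm_affine p (l : R) (b : V) u : (0 < p)%R -> (0 < l)%R ->
  measurable_field setT u ->
  Lp_norm p setT u = (((l ^+ 3) `^ p^-1)%R)%:E * Lp_norm p setT (u \o affine3 l b).
Proof.
move=> p0 l0 mu; rewrite !Lp_norm_setT (ge0_integral_affine b l0).
- rewrite poweRM ?poweR_EFin//.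
  + by rewrite lee_fin exprn_ge0// ltW.
  + by apply: integral_ge0 => x _; rewrite lee_fin powR_ge0.
- exact: mpow.
- by move=> x; rewrite lee_fin powR_ge0.
Qed.

Lemma Lp_normZ p (k : R) u : (0 < p)%R -> (0 <= k)%R -> measurable_field setT u ->
  Lp_norm p setT (k \*: u) = k%:E * Lp_norm p setT u.
Proof.
move=> p0 k0 mu; rewrite !Lp_norm_setT.
under eq_integral do rewrite norm3Z (ger0_norm k0) powRM ?norm3_ge0// EFinM.
rewrite ge0_integralZl//.
- rewrite poweRM ?lee_fin ?powR_ge0//.
    by rewrite poweR_EFin -powRrM mulfV ?gt_eqF// powRr1.
  by apply: integral_ge0 => x _; rewrite lee_fin powR_ge0.
- exact: mpow.
- by move=> x _; rewrite lee_fin powR_ge0.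
- by rewrite lee_fin powR_ge0.
Qed.
End Lp_norms.

(** * Weak curls and their pairings with test fields *)

Section weak_curls.
Context {R : realType}.
Local Notation V := (R * R * R)%type.
Local Notation M := (measurableTypeR R).
Implicit Types (u v w phi psi : V -> V) (Omega D K : set V).

Lemma measurable_fieldD u v : measurable_field setT u -> measurable_field setT v ->
  measurable_field setT (u \+ v).
Proof.
move=> /measurable_field_components[u1 u2 u3] /measurable_field_components[v1 v2 v3].
by do 2?apply: measurable_fun_pair; apply: measurable_funD.
Qed.

Lemma measurable_fieldZ (k : R) u : measurable_field setT u ->
  measurable_field setT (k \*: u).
Proof.
move=> /measurable_field_components[u1 u2 u3].
by do 2?apply: measurable_fun_pair; apply: measurable_funM.
Qed.

Lemma measurable_fieldB u v : measurable_field setT u -> measurable_field setT v ->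
  measurable_field setT (u \- v).
Proof.
move=> mu mv; have := measurable_fieldD mu (measurable_fieldZ (-1) mv).
by congr (measurable_field _ _); apply/funext => x /=; rewrite scaleN1r.
Qed.

Lemma measurable_fieldS Omega D u : measurable (Omega : set (M * M * M)) -> D `<=` Omega ->
  measurable_field Omega u -> measurable_field D u.
Proof. exact: measurable_funS. Qed.

Lemma test_field_bounded Omega phi : test_field Omega phi ->
  exists B, 0 < B /\ forall x, norm3 (phi x) <= B.
Proof.
move=> tphi; have [_ c _] := tphi.
have [|B [B0 hB]] := compact_supported_bounded
    (norm3_continuous (test_field_continuous tphi)) c.
  by move=> x /notin_support ->; exact: norm3_0.
by exists B; split => // x; rewrite -(ger0_norm (norm3_ge0 (phi x))).
Qed.

(** Additivity and changes of variables for the pairings in [is_weak_curl] ask for integrability. It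
    holds because [psi] is bounded with compact support in [Omega], where [u] is locally
    integrable. *)
Lemma integrable_dot3_test Omega u psi : measurable (Omega : set (M * M * M)) ->
  locally_integrable_field Omega u -> test_field Omega psi ->
  vol.-integrable (Omega : set (M * M * M))
    (EFin \o (fun x : M * M * M => dot3 (u x) (psi x))).
Proof.
move=> mO [mu lu] tpsi; have [_ c sub] := tpsi.
have [B [B0 psiB]] := test_field_bounded tpsi.
have mpsi : measurable_field Omega psi.
  apply: (measurable_fieldS measurableT) => //.
  exact: continuous_measurable_field (test_field_continuous tpsi).
pose K := closure [set x | psi x != 0].
apply: (@integrable_compact_supported_le _ Omega K _ (fun x => norm3 (u x) * B)) => //.
- exact: dot3_measurable.
- by apply: measurable_funM => //; exact: norm3_measurable.
- under eq_integral do rewrite EFinM.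
  rewrite ge0_integralZr//.
  + by rewrite muleC lte_mul_pinfty ?lee_fin ?ltW//; exact: lu.
  + exact: compact_measurable3.
  + apply/measurable_EFinP; apply: norm3_measurable; first exact: compact_measurable3.
    exact: measurable_fieldS mu.
  + by move=> x _; rewrite lee_fin norm3_ge0.
  + by rewrite lee_fin ltW.
- by move=> x; rewrite mulr_ge0 ?norm3_ge0// ltW.
- by move=> x _; rewrite (le_trans (cauchy_schwarz3 _ _))// ler_wpM2l// norm3_ge0.
- by move=> x _ /notin_support ->; rewrite dot3C dot3_0l.
Qed.

Lemma continuous_locally_integrable Omega u : measurable (Omega : set (M * M * M)) ->
  continuous u -> locally_integrable_field Omega u.
Proof.
move=> mO cu; split.
  apply: (measurable_fieldS measurableT) => //; exact: continuous_measurable_field.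
move=> K KO cK.
have [B [B0 hB]] : exists B, 0 < B /\ forall x, K x -> norm3 (u x) <= B.
  have : compact ((fun x => norm3 (u x)) @` K).
    apply: continuous_compact => //; apply: continuous_subspaceT.
    exact: norm3_continuous.
  move=> /compact_bounded /pinfty_ex_gt0[B B0 hB]; exists B; split => // x Kx.
  by rewrite -(ger0_norm (norm3_ge0 (u x))); apply: hB; exists x.
have mK := compact_measurable3 cK.
apply: (@le_lt_trans _ _ (\int[vol]_(x in K) B%:E)%E).
  apply: ge0_le_integral => //.
  - by move=> x _; rewrite lee_fin norm3_ge0.
  - apply/measurable_EFinP; apply: norm3_measurable => //.
    apply: (measurable_fieldS measurableT) => //; exact: continuous_measurable_field.
have -> : (\int[vol]_(x in K) B%:E = B%:E * vol K)%E by exact: (integral_cst vol mK B%:E).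
by rewrite lte_mul_pinfty ?lee_fin ?ltW// compact_vol_lty.
Qed.

Lemma Rintegral_ext0 Omega u v : measurable (Omega : set (M * M * M)) ->
  \int[vol]_(x in Omega) dot3 (u x) (v x) = \int[vol]_x dot3 (ext0 Omega u x) (v x).
Proof.
move=> mO; rewrite Rintegral_mkcond; apply: eq_Rintegral => x _.
rewrite patchE; case: ifPn => [|/negP] /[!inE] h.
  by rewrite (ext0_in _ h).
by rewrite (ext0_notin _ h) dot3_0l.
Qed.

Lemma Rintegral_support Omega u v : measurable (Omega : set (M * M * M)) ->
  (forall x, ~ Omega x -> v x = 0) ->
  \int[vol]_(x in Omega) dot3 (u x) (v x) = \int[vol]_x dot3 (u x) (v x).
Proof.
move=> mO v0; rewrite Rintegral_mkcond; apply: eq_Rintegral => x _.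
rewrite patchE; case: ifPn => [//|/negP h].
have vx : v x = 0 by apply: v0; move: h; rewrite inE.
by rewrite vx dot3C dot3_0l.
Qed.

Lemma test_field_notin Omega phi x : test_field Omega phi -> ~ Omega x -> phi x = 0.
Proof. by move=> [_ _ sub] Ox; apply: notin_support; apply: contra_not Ox; exact: sub. Qed.

(** The tests [psi] and [curl psi] vanish off [Omega], so both integrals extend to the whole space,
    where [curl_selfadjoint] applies. *)
Lemma weak_curl_test_field Omega phi : open Omega -> test_field Omega phi ->
  is_weak_curl Omega phi (curl phi).
Proof.
move=> oO tphi; have mO := open_measurable3 oO.
have tc := test_field_curl tphi.
have li := continuous_locally_integrable mO (test_field_continuous tphi).
have lic := continuous_locally_integrable mO (test_field_continuous tc).
split=> // psi tpsi.
rewrite (Rintegral_support _ mO (fun x => test_field_notin tpsi)).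
rewrite (Rintegral_support _ mO (fun x => test_field_notin (test_field_curl tpsi))).
exact: (curl_selfadjoint tphi tpsi).
Qed.

Lemma test_field_Lp p Omega phi : 0 < p -> open Omega -> test_field Omega phi ->
  in_Lp p Omega phi.
Proof.
move=> p0 oO tphi; have mO := open_measurable3 oO.
have cphi := test_field_continuous tphi; have [_ c _] := tphi.
split.
  apply: (measurable_fieldS measurableT) => //; exact: continuous_measurable_field.
rewrite Lp_norm_ext0 ext0_support; last by move=> x; exact: test_field_notin tphi.
rewrite Lp_norm_setT; apply: poweR_lty.
have [B [B0 phiB]] := test_field_bounded tphi.
have mpow : measurable_fun setT (fun x : M * M * M => norm3 (phi x) `^ p).
  apply: (measurableT_comp (measurable_powR p)).
  by apply: norm3_measurable => //; exact: continuous_measurable_field.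
have : vol.-integrable setT (EFin \o (fun x : M * M * M => norm3 (phi x) `^ p)).
  apply: (@integrable_compact_supported_le _ setT _ _ (fun=> B `^ p) _ c) => //.
  - have -> : (\int[vol]_(x in closure [set x | phi x != 0%R]) (B `^ p)%:E =
        (B `^ p)%:E * vol (closure [set x | phi x != 0%R]))%E.
      exact: (integral_cst vol (compact_measurable3 c) (B `^ p)%:E).
    by rewrite lte_mul_pinfty ?lee_fin ?powR_ge0// compact_vol_lty.
  - by move=> x; exact: powR_ge0.
  - move=> x _; rewrite ger0_norm ?powR_ge0//.
    by apply: ge0_ler_powR => //; rewrite ?nnegrE ?norm3_ge0// ltW.
  - by move=> x _ /notin_support ->; rewrite norm3_0 powR0// gt_eqF.
by move=> /integrableP[_]; under eq_integral do rewrite /= ger0_norm ?powR_ge0//.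
Qed.
End weak_curls.

(** * Test fields and weak curls under x -> l x + b *)

Section affine_invariance.
Context {R : realType}.
Local Notation V := (R * R * R)%type.
Local Notation M := (measurableTypeR R).
Implicit Types (u v w phi psi : V -> V) (Omega D K : set V).

Lemma affine3K (l : R) (b : V) : l != 0 ->
  cancel (affine3 l b) (affine3 l^-1 (- (l^-1 *: b))).
Proof.
by move=> l0 x; rewrite /affine3 scalerDr scalerA mulVf// scale1r addrK.
Qed.

Lemma affine3VK (l : R) (b : V) : l != 0 ->
  cancel (affine3 l^-1 (- (l^-1 *: b))) (affine3 l b).
Proof.
move=> l0 x; rewrite /affine3 scalerDr scalerA mulfV// scale1r scalerN scalerA.
by rewrite mulfV// scale1r subrK.
Qed.

Lemma affine3_continuous (l : R) (b : V) : continuous (affine3 l b).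
Proof.
move=> x; apply: cvgD; last exact: cvg_cst.
by apply: cvgZ; [exact: cvg_cst|exact: cvg_id].
Qed.

Lemma measurable_field_affine (l : R) (b : V) u : measurable_field setT u ->
  measurable_field setT (u \o affine3 l b).
Proof. by move=> mu; exact: (measurableT_comp mu (measurable_affine3 l b)). Qed.

Lemma compact_affine (l : R) (b : V) K : compact K -> compact (affine3 l b @` K).
Proof.
move=> cK; apply: continuous_compact => //; apply: continuous_subspaceT.
exact: affine3_continuous.
Qed.

Lemma affine3_preimage (l : R) (b : V) K : l != 0 ->
  affine3 l b @^-1` K = affine3 l^-1 (- (l^-1 *: b)) @` K.
Proof.
move=> l0; apply/seteqP; split => [x Kx|_ [y Ky <-]].
  by exists (affine3 l b x) => //; rewrite affine3K.
by rewrite /preimage/= affine3VK.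
Qed.

Lemma in_Lp_affine p (l : R) (b : V) u : 0 < p -> 0 < l -> in_Lp p setT u ->
  in_Lp p setT (u \o affine3 l b).
Proof.
move=> p0 l0 [mu loo]; split; first exact: measurable_field_affine.
move: loo; rewrite (Lp_norm_affine b p0 l0 mu).
have := Lp_norm_ge0 p setT (u \o affine3 l b).
case: (Lp_norm p setT (u \o affine3 l b)) => [r _ _||//]; first by rewrite ltry.
by move=> _; rewrite gt0_muley// lte_fin powR_gt0// exprn_gt0.
Qed.

Lemma test_field_affine Omega (l : R) (b : V) phi : l != 0 ->
  test_field setT phi ->
  affine3 l b @^-1` closure [set x | phi x != 0] `<=` Omega ->
  test_field Omega (phi \o affine3 l b).
Proof.
move=> l0 [s c _] sub.
have cl : closed (affine3 l b @^-1` closure [set x | phi x != 0]).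
  apply: closed_comp; last exact: closed_closure.
  by move=> x _; exact: affine3_continuous.
have sub' : closure [set x | (phi \o affine3 l b) x != 0] `<=`
    affine3 l b @^-1` closure [set x | phi x != 0].
  rewrite [X in _ `<=` X](closure_id _).1//; apply: closureS => x /= h.
  exact: subset_closure.
split.
- exact: smooth_affine.
- apply: (subclosed_compact _ _ sub'); first exact: closed_closure.
  by rewrite affine3_preimage//; exact: compact_affine.
- by move=> x /sub' /sub.
Qed.

Lemma curl_affine (l : R) (b : V) phi : smooth phi ->
  curl (phi \o affine3 l b) = l \*: (curl phi \o affine3 l b).
Proof.
move=> s; apply/funext => x.
have E d : 'D_d (phi \o affine3 l b) x = l *: 'D_d phi (affine3 l b x).
  exact: (derive_affine d (smooth_differentiable _ s)).2.
rewrite /curl !E /=.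
move: ('D_(1, 0, 0) phi (affine3 l b x)) ('D_(0, 1, 0) phi (affine3 l b x))
  ('D_(0, 0, 1) phi (affine3 l b x)) => d1 d2 d3.
have sE (y z : R) : y *: z = y * z by [].
by congr (_, _, _) => /=; rewrite !sE; ring.
Qed.

Lemma dot3Zl (k : R) (a b : V) : dot3 (k *: a) b = k * dot3 a b.
Proof.
have sE (y z : R) : y *: z = y * z by [].
by rewrite /dot3 /= !sE; ring.
Qed.

Lemma locally_integrable_affine (l : R) (b : V) u : 0 < l ->
  locally_integrable_field setT u -> locally_integrable_field setT (u \o affine3 l b).
Proof.
move=> l0 [mu lu]; split; first exact: measurable_field_affine.
move=> K _ cK.
have cTK := compact_affine (l := l) (b := b) cK.
have mTK := compact_measurable3 cTK.
have nu := norm3_measurable measurableT mu.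
have := lu _ (@subsetT _ _) cTK.
rewrite integral_mkcond (ge0_integral_affine b l0).
- have -> : (\int[vol]_x ((fun y => (norm3 (u y))%:E) \_ (affine3 l b @` K)) (affine3 l b x))%E
     = (\int[vol]_(x in K) (norm3 ((u \o affine3 l b) x))%:E)%E.
    rewrite [RHS]integral_mkcond; apply: eq_integral => x _; rewrite !patchE.
    have [Kx|Kx] := pselect (K x).
      by rewrite !mem_set//; exists x.
    rewrite !memNset// => -[y Ky] /(can_inj (affine3K b (lt0r_neq0 l0))) yx.
    by apply: Kx; rewrite -yx.
  have := @integral_ge0 _ _ _ vol K (fun x => (norm3 ((u \o affine3 l b) x))%:E).
  (* Only finiteness is transferred: an infinite integral over [K], times l^3 > 0, would make the
     one over the image infinite. *)
  case: (\int[vol]_(x in K) _)%E => [r _|_|h].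
  + by move=> _; exact: ltry.
  + by rewrite gt0_muley// lte_fin exprn_gt0.
  + by have : (0 <= -oo :> \bar R)%E by apply: h => x _; rewrite lee_fin norm3_ge0.
- apply/(measurable_restrictT _ mTK)/measurable_EFinP.
  apply: norm3_measurable => //; exact: measurable_fieldS mu.
- by move=> x; rewrite patchE; case: ifP => // _; rewrite lee_fin norm3_ge0.
Qed.

Lemma locally_integrableZ (k : R) u : 0 <= k ->
  locally_integrable_field setT u -> locally_integrable_field setT (k \*: u).
Proof.
move=> k0 [mu lu]; split; first exact: measurable_fieldZ.
move=> K KT cK; have mK := compact_measurable3 cK.
under eq_integral do rewrite norm3Z (ger0_norm k0) EFinM.
rewrite ge0_integralZl//.
- by apply: lte_mul_pinfty => //; exact: lu.
- apply/measurable_EFinP; apply: (norm3_measurable mK).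
  by apply: measurable_fieldS mu.
- by move=> x _; rewrite lee_fin norm3_ge0.
Qed.

(** Testing with [psi] amounts to testing the original pair with [chi], that is [psi] composed with
    the inverse map. The Jacobian l^3 cancels on both sides, and [curl_affine] contributes the
    factor [l]. *)
Lemma weak_curl_affine (l : R) (b : V) u v : 0 < l ->
  is_weak_curl setT u v -> is_weak_curl setT (u \o affine3 l b) (l \*: (v \o affine3 l b)).
Proof.
move=> l0 [lu lv uv]; have ln0 := lt0r_neq0 l0.
split.
- exact: locally_integrable_affine.
- apply: locally_integrableZ; [exact: ltW|exact: locally_integrable_affine].
move=> psi tpsi.
pose chi := psi \o affine3 l^-1 (- (l^-1 *: b)).
have tchi : test_field setT chi.
  by apply: test_field_affine => //; rewrite invr_neq0.
have psiE : psi = chi \o affine3 l b.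
  by apply/funext => x; rewrite /chi /= affine3K.
have [schi _ _] := tchi.
have i1 := integrable_dot3_test measurableT lu (test_field_curl tchi).
have i2 := integrable_dot3_test measurableT lv tchi.
have E := uv _ tchi.
rewrite (Rintegral_affine b l0 i1) (Rintegral_affine b l0 i2) in E.
have {}E := mulfI (lt0r_neq0 (exprn_gt0 3 l0)) E.
rewrite psiE (curl_affine _ _ schi).
transitivity (l * \int[vol]_x dot3 (u (affine3 l b x)) (curl chi (affine3 l b x))).
  have h := RintegralZl l measurableT (integrable_affine b l0 i1).
  apply: etrans h; apply: eq_Rintegral => x _ /=.
  by rewrite dot3C dot3Zl dot3C.
rewrite E.
have h := RintegralZl l measurableT (integrable_affine b l0 i2).
apply: etrans (esym h) _; apply: eq_Rintegral => x _ /=.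
by rewrite dot3Zl.
Qed.
End affine_invariance.

(** * The spaces [W06curl] and [curl_free], and their affine invariance *)

Section energy_spaces.
Context {R : realType}.
Local Notation V := (R * R * R)%type.
Local Notation M := (measurableTypeR R).
Implicit Types (u v w phi psi : V -> V) (Omega D K : set V).

Lemma hypote_lt (a b : \bar R) (e : R) : (0 <= a)%E -> (0 <= b)%E ->
  ((a ^+ 2 + b ^+ 2) `^ 2^-1 < e%:E)%E -> (a < e%:E)%E /\ (b < e%:E)%E.
Proof.
case: a b => [a||] [b||] //; rewrite ?lee_fin => a0 b0; last first.
- by rewrite expe2 mulyy addye ?poweRyr.
- by rewrite expe2 mulyy addye ?poweRyr// -EFin_expe.
- by rewrite [X in (_ + X)%E]expe2 mulyy addey ?poweRyr// -EFin_expe.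
rewrite -!EFin_expe -EFinD poweR_EFin powR12_sqrt ?addr_ge0 ?sqr_ge0// !lte_fin => h.
by split; apply: le_lt_trans h; rewrite -[leLHS]ger0_norm// -sqrtr_sqr
  ler_wsqrtr// (lerDl, lerDr) sqr_ge0.
Qed.

Lemma hypoteZ (k : R) (a b : \bar R) : 0 <= k -> (0 <= a)%E -> (0 <= b)%E ->
  (((k%:E * a) ^+ 2 + (k%:E * b) ^+ 2) `^ 2^-1 = k%:E * (a ^+ 2 + b ^+ 2) `^ 2^-1)%E.
Proof.
move=> k0 a0 b0; rewrite !expe2 (muleACA _ a) (muleACA _ b) -ge0_muleDr ?mule_ge0// -EFinM.
rewrite poweRM ?lee_fin ?mulr_ge0// ?adde_ge0 ?mule_ge0//.
by rewrite poweR_EFin powR12_sqrt ?mulr_ge0// -expr2 sqrtr_sqr ger0_norm.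
Qed.

Lemma Lp_norm0 p Omega : 0 < p -> Lp_norm p Omega (cst 0) = 0%E.
Proof.
move=> p0; rewrite Lp_norm_ext0.
have -> : ext0 Omega (cst 0) = cst (0 : V).
  by apply/funext => x; rewrite /ext0 /patch; case: ifP.
rewrite Lp_norm_setT; under eq_integral do rewrite norm3_0 powR0 ?gt_eqF//.
by rewrite integral0 poweR0r// invr_neq0 ?gt_eqF.
Qed.

Lemma weak_curl0 Omega : measurable (Omega : set (M * M * M)) ->
  is_weak_curl Omega (cst 0) (cst 0).
Proof.
move=> mO.
have li : locally_integrable_field Omega (cst 0).
  by apply: continuous_locally_integrable => // x; exact: cvg_cst.
by split => // psi tpsi; apply: eq_Rintegral => x _; rewrite !dot3_0l.
Qed.

Lemma test_field_W06curl Omega phi : open Omega -> test_field Omega phi ->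
  W06curl Omega phi.
Proof.
move=> oO tphi; split.
  split; first exact: test_field_Lp.
  exists (curl phi); split; first exact: weak_curl_test_field.
  by apply: test_field_Lp => //; exact: test_field_curl.
move=> e e0; exists phi; split => //; exists (cst 0).
have -> : phi \- phi = cst 0 by apply/funext => x /=; rewrite subrr.
split; first by apply: weak_curl0; exact: open_measurable3.
by rewrite /W6curl_norm !Lp_norm0// expe2 mule0 adde0 poweR0r ?lte_fin// invr_neq0.
Qed.

(* [dil l = l^(-1/2)]: precomposition with [affine3 l b] multiplies both the L^6
   norm of a field and the L^2 norm of its curl by this factor. *)
Definition dil (l : R) : R := ((l ^+ 3) `^ 6^-1)^-1.

Lemma dil_gt0 l : 0 < l -> 0 < dil l.
Proof. by move=> l0; rewrite /dil invr_gt0 powR_gt0// exprn_gt0. Qed.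

Lemma Lp_norm6_affine (l : R) (b : V) u : 0 < l -> measurable_field setT u ->
  (Lp_norm 6 setT (u \o affine3 l b) = (dil l)%:E * Lp_norm 6 setT u)%E.
Proof.
move=> l0 mu; rewrite (Lp_norm_affine b _ l0 mu)// muleA -EFinM mulVf ?mul1e//.
by rewrite gt_eqF// powR_gt0// exprn_gt0.
Qed.

(** The factor is [l] from the chain rule times l^(-3/2) from the volume. It equals the L^6 factor
    l^(-3/6) because 3/2 - 3/6 = 1: this is where 6 is the critical exponent. *)
Lemma Lp_norm2_affine (l : R) (b : V) v : 0 < l -> measurable_field setT v ->
  (Lp_norm 2 setT (l \*: (v \o affine3 l b)) = (dil l)%:E * Lp_norm 2 setT v)%E.
Proof.
move=> l0 mv; rewrite Lp_normZ ?ltW//; last exact: measurable_field_affine.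
rewrite (Lp_norm_affine b _ l0 mv)// muleA -EFinM; congr (_%:E * _)%E.
rewrite /dil -(powR_mulrn 3 (ltW l0)) -!powRrM mulrC -powRB; last by rewrite (gt_eqF l0) implybT.
have -> : 3%:R * 2^-1 - 3%:R * 6^-1 = 1 :> R by field.
by rewrite powRr1// ltW.
Qed.

Lemma W06curl_affine (l : R) (b : V) w : 0 < l -> W06curl setT w ->
  W06curl setT (w \o affine3 l b).
Proof.
move=> l0 [[w6 [v [wv v2]]] appr]; split.
  split; first exact: in_Lp_affine.
  exists (l \*: (v \o affine3 l b)); split; first exact: weak_curl_affine.
  have [mv' voo] := in_Lp_affine b (ltr0n _ 2) l0 v2; have [mv _] := v2.
  split; first exact: measurable_fieldZ.
  rewrite Lp_norm2_affine//; apply: lte_mul_pinfty => //.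
    by rewrite lee_fin ltW// dil_gt0.
  by case: v2.
(* Both parts of the norm get multiplied by [dil l], so the original field is approximated within
   [e / dil l]. *)
move=> e e0; have [phi [tphi [z [wz ze]]]] := appr (e / dil l) (divr_gt0 e0 (dil_gt0 l0)).
exists (phi \o affine3 l b); split.
  by apply: test_field_affine => //; rewrite gt_eqF.
exists (l \*: (z \o affine3 l b)).
have -> : (w \o affine3 l b) \- (phi \o affine3 l b) = (w \- phi) \o affine3 l b by [].
split; first exact: weak_curl_affine.
have [[mwz _] [mz _] _] := wz.
rewrite /W6curl_norm Lp_norm6_affine// Lp_norm2_affine//.
rewrite hypoteZ ?Lp_norm_ge0 ?ltW ?dil_gt0//.
by rewrite -lte_pdivlMl ?dil_gt0// muleC -EFinM.
Qed.

Lemma curl_free_affine (l : R) (b : V) w : 0 < l -> curl_free w ->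
  curl_free (w \o affine3 l b).
Proof.
move=> l0 [w1 w2]; split; first exact: W06curl_affine.
have := weak_curl_affine b l0 w2; congr is_weak_curl.
by apply/funext => x /=; rewrite scaler0.
Qed.

(** Ensures that the rescaled copy of a field that is not curl-free remains an admissible competitor
    in [Scurl_bound]. *)
Lemma curl_free_affine_inv (l : R) (b : V) w : 0 < l -> curl_free (w \o affine3 l b) ->
  curl_free w.
Proof.
move=> l0 cw; have l'0 : 0 < l^-1 by rewrite invr_gt0.
have := curl_free_affine (- (l^-1 *: b)) l'0 cw; congr curl_free.
by apply/funext => x /=; rewrite affine3VK// gt_eqF.
Qed.

(** Makes [- phi] available as [w] when [phi] is a curl-free test field, so that [phi + w]
    vanishes. *)
Lemma curl_freeN phi : test_field setT phi -> curl_free phi -> curl_free (\- phi).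
Proof.
move=> tphi [_ [lphi l0 h]]; split.
  by apply: test_field_W06curl; [exact: openT|exact: test_fieldN].
split => //.
  apply: continuous_locally_integrable => //.
  exact: test_field_continuous (test_fieldN tphi).
move=> psi tpsi; have := h psi tpsi.
have -> : \int[vol]_x dot3 (cst 0 x) (psi x) = 0 :> R.
  under eq_Rintegral do rewrite dot3_0l.
  by rewrite /Rintegral integral0.
move=> h0; have i1 := integrable_dot3_test measurableT lphi (test_field_curl tpsi).
have h1 := RintegralZl (-1) measurableT i1.
rewrite [X in -1 * X]h0 mulr0 in h1; apply: etrans h1.
by apply: eq_Rintegral => x _; rewrite -[(\- phi) x]scaleN1r dot3Zl.
Qed.
End energy_spaces.

(** * Admissible constants and the comparison of domains *)

Section Scurl_bounds.
Context {R : realType}.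
Local Notation V := (R * R * R)%type.
Local Notation M := (measurableTypeR R).
Implicit Types (u v w phi psi : V -> V) (Omega D K : set V) (S : R).

Definition quotient_set u : set (\bar R) :=
  [set ((\int[vol]_x (norm3 (u x + w x) ^+ 6)%:E) `^ 3^-1)%E | w in curl_free].

Lemma quotient_setE u w :
  ((\int[vol]_x (norm3 (u x + w x) ^+ 6)%:E) `^ 3^-1 = Lp_norm 6 setT (u \+ w)%R ^+ 2)%E.
Proof. exact: Lp_norm6_sqr. Qed.

(** If no [w] worked, every norm would be at least t = (r + e) / sqrt S, so the left side of the
    hypothesis would be at least (r + e)^2 > r^2. *)
Lemma near_minimizer S u (r e : R) : 0 < S -> 0 <= r -> 0 < e ->
  (S%:E * ereal_inf (quotient_set u) <= (r ^+ 2)%:E)%E ->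
  exists2 w, curl_free w &
    ((Num.sqrt S)%:E * Lp_norm 6 setT (u \+ w)%R <= (r + e)%:E)%E.
Proof.
move=> S0 r0 e0 h; apply: contrapT => nex.
have s0 : 0 < Num.sqrt S by rewrite sqrtr_gt0.
pose t := (r + e) / Num.sqrt S.
have t0 : 0 <= t by rewrite divr_ge0 ?addr_ge0//; exact: ltW.
have lb : ((t ^+ 2)%:E <= ereal_inf (quotient_set u))%E.
  apply/ereal_infP => _ [w cw <-]; rewrite quotient_setE.
  have tw : (t%:E <= Lp_norm 6 setT (u \+ w)%R)%E.
    rewrite leNgt; apply/negP => wt; apply: nex; exists w => //.
    by rewrite -lee_pdivlMl// muleC -EFinM -/t ltW.
  by rewrite expr2 EFinM expe2; apply: lee_pmul.
have : (S%:E * (t ^+ 2)%:E <= (r ^+ 2)%:E)%E.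
  by apply: le_trans h; rewrite lee_pmul2l.
have -> : (S%:E * (t ^+ 2)%:E = ((r + e) ^+ 2)%:E)%E.
  by rewrite -EFinM /t expr_div_n (sqr_sqrtr (ltW S0)) mulrC divfK// gt_eqF.
rewrite lee_fin.
by rewrite ler_pXn2r ?nnegrE ?addr_ge0 ?(ltW e0)// gerDl leNgt e0.
Qed.

Lemma le_of_near_minimizers S u (r : R) : 0 < S -> 0 <= r ->
  (forall e, 0 < e -> exists2 w, curl_free w &
    ((Num.sqrt S)%:E * Lp_norm 6 setT (u \+ w)%R <= (r + e)%:E)%E) ->
  (S%:E * ereal_inf (quotient_set u) <= (r ^+ 2)%:E)%E.
Proof.
move=> S0 r0 h; apply/lee_addgt0Pr => d d0.
have D0 : 0 < 2 * r + 1 by rewrite ltr_wpDl// mulr_ge0.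
(* Chosen so that (r + e)^2 <= r^2 + e (2 r + 1) <= r^2 + d; the first inequality uses e <= 1. *)
pose e := Num.min 1 (d / (2 * r + 1)).
have e0 : 0 < e by rewrite lt_min ltr01 divr_gt0.
have [w cw hw] := h e e0.
have s0 : 0 <= Num.sqrt S by exact: sqrtr_ge0.
apply: (@le_trans _ _ (S%:E * Lp_norm 6 setT (u \+ w)%R ^+ 2)%E).
  rewrite lee_pmul2l//; apply: ereal_inf_lbound; exists w => //.
  exact: quotient_setE.
apply: (@le_trans _ _ ((r + e) ^+ 2)%:E).
  rewrite -{1}(sqr_sqrtr (ltW S0)) expe2 !expr2 !EFinM muleACA.
  by apply: lee_pmul => //; rewrite mule_ge0// Lp_norm_ge0.
rewrite -EFinD lee_fin sqrrD -addrA lerD2l.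
have e1 : e <= 1 by rewrite ge_min lexx.
have ed : e * (2 * r + 1) <= d by rewrite -ler_pdivlMr// ge_min lexx orbT.
apply: le_trans ed; rewrite mulrDr mulr1 expr2 lerD//.
  by rewrite -mulr_natl; have -> : 2%:R * (r * e) = e * (2 * r) by ring.
by rewrite -[leRHS]mulr1 ler_wpM2l// ltW.
Qed.

(** The infimum is nonnegative, so the left side is at most 0. This leaves S > 0, where one can
    divide by sqrt S. *)
Lemma Scurl_bound_le0 Omega S : S <= 0 -> Scurl_bound Omega S.
Proof.
move=> S0 u _ _ v _; apply: (@le_trans _ _ 0%E).
  apply: mule_le0_ge0; first by rewrite lee_fin.
  by apply/ereal_infP => _ [w _ <-]; exact: poweR_ge0.
by apply: integral_ge0 => x _; rewrite lee_fin exprn_ge0// norm3_ge0.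
Qed.

(* The inequality for smooth fields, with square roots taken on both sides so that
   it passes to limits by Minkowski's inequality. *)
Definition test_bound S := forall phi, test_field setT phi -> forall e, 0 < e ->
  exists2 w, curl_free w & ((Num.sqrt S)%:E * Lp_norm 6 setT (phi \+ w)%R <=
    Lp_norm 2 setT (curl phi) + e%:E)%E.

Lemma curl_free_measurable w : curl_free w -> measurable_field setT w.
Proof. by move=> [_ [[mw _] _ _]]. Qed.

Lemma Scurl_bound_test Omega S : open Omega -> Omega !=set0 -> 0 < S ->
  Scurl_bound Omega S -> test_bound S.
Proof.
move=> oO [x0 Ox0] S0 bnd phi tphi e e0.
have mphi := continuous_measurable_field (test_field_continuous tphi).
(* [Scurl_bound] says nothing about curl-free fields; for these [w = - phi] makes the left side
   0. *)
have [cphi|ncphi] := pselect (curl_free phi).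
  exists (\- phi); first exact: curl_freeN.
  have -> : phi \+ (\- phi) = cst 0 by apply/funext => x /=; rewrite subrr.
  by rewrite Lp_norm0// mule0 adde_ge0 ?Lp_norm_ge0// lee_fin ltW.
have [r r0 ballO] : exists2 r : R, 0 < r & ball x0 r `<=` Omega.
  by have /nbhs_ballP[r /= r0 h] := open_nbhs_nbhs (conj oO Ox0); exists r.
have [_ cK _] := tphi.
have [B B0 KB] := pinfty_ex_gt0 (compact_bounded cK).
(* The map sends [x0] to 0, and [B] bounds the support of [phi]. On the preimage of the support l |x
   - x0| <= B, hence |x - x0| <= r/2 < r. *)
pose l := 2 * B / r; pose b := - (l *: x0).
have l0 : 0 < l by rewrite divr_gt0// mulr_gt0.
have tO : test_field Omega (phi \o affine3 l b).
  apply: test_field_affine => //; first by rewrite gt_eqF.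
  move=> x Kx; apply: ballO; rewrite -ball_normE /= distrC.
  have h : `|affine3 l b x| <= B by exact: KB.
  rewrite /affine3 /b -scalerBr normrZ (gtr0_norm l0) in h.
  rewrite -(ltr_pM2l l0); apply: le_lt_trans h _.
  by rewrite /l divfK ?gt_eqF// ltr_pMl// ltr1n.
have tT : test_field setT (phi \o affine3 l b) := test_fieldW (@subsetT _ _) tO.
have extE : ext0 Omega (phi \o affine3 l b) = phi \o affine3 l b.
  by apply: ext0_support => x; exact: test_field_notin tO.
have := bnd _ (test_field_W06curl oO tO).
rewrite extE => /(_ (fun h => ncphi (curl_free_affine_inv l0 h))).
move=> /(_ _ (weak_curl_test_field openT tT)).
have [sphi _ _] := tphi.
have tc := test_field_curl tphi.
have mc := continuous_measurable_field (test_field_continuous tc).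
rewrite -Lp_norm2_sqr curl_affine// Lp_norm2_affine//.
have [_] := test_field_Lp (ltr0n _ 2) openT tc.
have := Lp_norm_ge0 2 setT (curl phi).
case: (Lp_norm 2 setT (curl phi)) => [N||] //; rewrite lee_fin => N0 _.
have d0 := dil_gt0 l0.
(* The error is taken as [dil l * e] because the common factor [dil l] is divided out at the end. *)
rewrite -EFinM -EFin_expe => /(near_minimizer S0 (mulr_ge0 (ltW d0) N0) (mulr_gt0 d0 e0)).
move=> [w cw hw].
pose w' := w \o affine3 l^-1 (- (l^-1 *: b)).
have cw' : curl_free w' by apply: curl_free_affine => //; rewrite invr_gt0.
have wE : w = w' \o affine3 l b.
  by apply/funext => x; rewrite /w' /= affine3K// gt_eqF.
exists w' => //; move: hw.
have -> : (phi \o affine3 l b) \+ w = (phi \+ w') \o affine3 l b by rewrite {1}wE.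
rewrite Lp_norm6_affine//; last first.
  exact: measurable_fieldD mphi (curl_free_measurable cw').
by rewrite -mulrDr EFinM muleCA lee_pmul2l// ?lte_fin// EFinD.
Qed.

Lemma ext0B Omega u phi : test_field Omega phi ->
  ext0 Omega (u \- phi) = ext0 Omega u \- phi.
Proof.
move=> tphi; apply/funext => x; have [Ox|Ox] := pselect (Omega x).
  by rewrite /= !ext0_in.
by rewrite /= !ext0_notin// (test_field_notin tphi Ox) subrr.
Qed.

Lemma dot3B (a b c : V) : dot3 (a - b) c = dot3 a c - dot3 b c.
Proof. by rewrite /dot3 /=; ring. Qed.

(* [curl phi] is itself a test field: testing both weak curls against it gives
   [|curl phi|^2 = int (v - z) . curl phi]. This replaces the uniqueness of weak
   curls up to null sets. *)
Lemma curl_approximant_le Omega u v phi z : open Omega ->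
  is_weak_curl setT (ext0 Omega u) v -> test_field Omega phi ->
  is_weak_curl Omega (u \- phi) z ->
  (Lp_norm 2 setT (curl phi) <= Lp_norm 2 setT v + Lp_norm 2 Omega z)%E.
Proof.
move=> oO [lu lv uv] tphi [luphi lz uz]; have mO := open_measurable3 oO.
pose psi := curl phi.
have tpsi : test_field Omega psi := test_field_curl tphi.
have tcpsi := test_field_curl tpsi.
have toT chi : test_field Omega chi -> test_field setT chi.
  exact: (test_fieldW (@subsetT _ _)).
have extB := ext0B u tphi.
have i1 := integrable_dot3_test measurableT lu (toT _ tcpsi).
have i2 := integrable_dot3_test measurableT lv (toT _ tpsi).
have i3 : vol.-integrable setT (EFin \o (fun x : M * M * M => dot3 (ext0 Omega z x) (psi x))).
  have /(integrable_mkcond _ mO) := integrable_dot3_test mO lz tpsi.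
  congr (vol.-integrable setT _); apply/funext => x; rewrite patchE.
  case: ifPn => [|/negP] /[!inE] h /=.
    by rewrite (ext0_in _ h).
  by rewrite (ext0_notin _ h) dot3_0l.
have i4 := integrable_dot3_test_fields tphi (test_field_continuous tcpsi).
have mpsi := continuous_measurable_field (test_field_continuous tpsi).
have E : \int[vol]_x dot3 (psi x) (psi x) =
    \int[vol]_x dot3 (v x) (psi x) - \int[vol]_x dot3 (ext0 Omega z x) (psi x).
  have sa : \int[vol]_x dot3 (phi x) (curl psi x) = \int[vol]_x dot3 (psi x) (psi x).
    exact: (curl_selfadjoint tphi tpsi).
  have uvE := uv _ (toT _ tpsi).
  have uzE := etrans (esym (Rintegral_ext0 (u \- phi) (curl psi) mO))
    (etrans (uz _ tpsi) (Rintegral_ext0 z psi mO)).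
  have diffE : \int[vol]_x dot3 (ext0 Omega (u \- phi) x) (curl psi x) =
      \int[vol]_x dot3 (ext0 Omega u x) (curl psi x) - \int[vol]_x dot3 (phi x) (curl psi x).
    apply: etrans (RintegralB measurableT i1 i4); apply: eq_Rintegral => x _.
    by rewrite extB dot3B.
  have arith (c1 c2 c3 c4 c5 c6 : R) :
      c1 = c2 -> c3 = c4 -> c5 = c6 -> c5 = c3 - c1 -> c2 = c4 - c6.
    by move=> -> -> -> ->; ring.
  exact: (arith _ _ _ _ _ _ sa uvE uzE diffE).
have [_ Pfin] := test_field_Lp (ltr0n _ 2) openT (toT _ tpsi).
have hv := Lp_norm_hoelder lv.1 mpsi i2.
have hz := Lp_norm_hoelder (ext0_measurable mO lz.1) mpsi i3.
rewrite (Lp_norm_ext0 2 Omega z) -/psi.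
have sq : (Lp_norm 2 setT psi ^+ 2 = (\int[vol]_x dot3 (psi x) (psi x))%:E)%E.
  rewrite Lp_norm2_sqr /Rintegral fineK; last first.
    exact: (integrable_fin_num measurableT (integrable_dot3_test_fields tpsi (test_field_continuous tpsi))).
  by apply: eq_integral => x _; rewrite norm3_sqr.
have key : (Lp_norm 2 setT psi ^+ 2 <=
    (Lp_norm 2 setT v + Lp_norm 2 setT (ext0 Omega z)) * Lp_norm 2 setT psi)%E.
  rewrite sq E ge0_muleDl ?Lp_norm_ge0//; apply: le_trans (leeD hv hz).
  by rewrite -EFinD lee_fin (le_trans (ler_norm _))// ler_normB.
have := Lp_norm_ge0 2 setT psi; move: Pfin key.
case: (Lp_norm 2 setT psi) => [P||] // _ + P0; rewrite lee_fin in P0.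
(* The bound [key] is divided by [P], which is finite; the case P = 0 is immediate. *)
have [P00|P0'] := eqVneq P 0.
  by rewrite P00 => _; rewrite adde_ge0 ?Lp_norm_ge0.
by rewrite expe2 lee_pmul2r// lte_fin lt_neqAle eq_sym P0' P0.
Qed.

(** The field [w] is chosen for the approximant [phi] and reused for [u]: Minkowski's inequality
    controls |u + w|_6 by |u - phi|_6 + |phi + w|_6, and [curl_approximant_le] returns from
    [curl phi] to [v]. *)
Lemma test_bound_Scurl Omega S : open Omega -> 0 < S -> test_bound S ->
  Scurl_bound Omega S.
Proof.
move=> oO S0 tb u [[u6 _] appr] _ v uv; have mO := open_measurable3 oO.
rewrite -Lp_norm2_sqr -/(quotient_set (ext0 Omega u)).
have := curl_approximant_le oO uv.
have := Lp_norm_ge0 2 setT v.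
(* If [v] is not square integrable, the right side is infinite. *)
case: (Lp_norm 2 setT v) => [r||] // r0 curl_le; last by rewrite expe2 mulyy leey.
rewrite lee_fin in r0.
rewrite -EFin_expe; apply: le_of_near_minimizers => // e e0.
have s0 : 0 < Num.sqrt S by rewrite sqrtr_gt0.
have s2 : 0 < Num.sqrt S + 2 by rewrite addr_gt0.
(* The errors add up to sqrt S d + d + d: one from |u - phi|_6, one from the curls, one from the
   choice of [w]. *)
pose d := e / (Num.sqrt S + 2); have d0 : 0 < d by rewrite divr_gt0.
have [phi [tphi [z [wz]]]] := appr d d0.
move=> /(hypote_lt (Lp_norm_ge0 _ _ _) (Lp_norm_ge0 _ _ _))[h6 h2].
have tT : test_field setT phi := test_fieldW (@subsetT _ _) tphi.
have [w cw hw] := tb _ tT d d0; exists w => //.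
have mphi := continuous_measurable_field (test_field_continuous tT).
have mw := curl_free_measurable cw.
have mu := ext0_measurable mO u6.1.
have extB := ext0B u tphi.
have split6 : (Lp_norm 6 setT (ext0 Omega u \+ w)%R <=
    Lp_norm 6 Omega (u \- phi)%R + Lp_norm 6 setT (phi \+ w)%R)%E.
  rewrite (Lp_norm_ext0 6 Omega) extB.
  have -> : ext0 Omega u \+ w = (ext0 Omega u \- phi) \+ (phi \+ w).
    by apply/funext => x /=; rewrite addrA subrK.
  apply: Lp_normD; [by rewrite ler1n|exact: measurable_fieldB|exact: measurable_fieldD].
apply: (@le_trans _ _ ((Num.sqrt S)%:E * (d%:E + Lp_norm 6 setT (phi \+ w)%R))%E).
  by rewrite lee_pmul2l//; apply: le_trans split6 _; rewrite leeD2r// ltW.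
rewrite ge0_muleDr; [|by rewrite lee_fin ltW|exact: Lp_norm_ge0].
apply: (@le_trans _ _ ((Num.sqrt S * d)%:E + (r%:E + d%:E + d%:E))%E).
  rewrite EFinM leeD2l//; apply: le_trans hw _; rewrite leeD2r//.
  by apply: le_trans (curl_le _ _ tphi wz) _; rewrite leeD2l// ltW.
rewrite -!EFinD lee_fin.
have -> : Num.sqrt S * d + (r + d + d) = r + d * (Num.sqrt S + 2) by ring.
by rewrite /d divfK// gt_eqF.
Qed.

(** For S > 0 the passage goes through [test_bound S], in which no domain occurs. *)
Lemma Scurl_bound_indep Omega Omega' S : open Omega -> open Omega' ->
  Omega !=set0 -> Scurl_bound Omega S -> Scurl_bound Omega' S.
Proof.
move=> oO oO' O0 bnd; have [S0|S0] := leP S 0; first exact: Scurl_bound_le0.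
exact: (test_bound_Scurl oO' S0 (Scurl_bound_test oO O0 S0 bnd)).
Qed.
End Scurl_bounds.

Theorem theorem1p1 (R : realType) (Omega : set (R * R * R)) :
  lipschitz_domain Omega -> Scurl Omega = Scurl [set: R * R * R].
Proof.
move=> [oO _ O0 _]; have T0 : [set: R * R * R] !=set0 by exists 0.
(* The suprema agree because the sets of admissible constants do. *)
rewrite /Scurl; congr ereal_sup; congr (image _ _); apply/seteqP.
by split => S; apply: Scurl_bound_indep => //; exact: openT.
Qed.
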